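(* Let $A \in \mathbb{R}^{m \times n}$ be a matrix each of whose columns has $\ell_2$ norm at most $1$. Then $\mathsf{disc}(A) = \widetilde{O}(\log^{1/4} n)$.
   Context: For a matrix $A \in \mathbb{R}^{m\times n}$, $\mathsf{disc}(A) := \min_{x \in \{-1,1\}^n} \|Ax\|_\infty$. The notation $\widetilde{O}(\cdot)$ hides factors polynomial in $\log\log n$. *)

(* Defs.v *)
From HB Require Import structures.
From mathcomp Require Import all_boot all_order all_algebra.
From mathcomp Require Import all_classical all_reals all_analysis.

Set Implicit Arguments.
Unset Strict Implicit.
Unset Printing Implicit Defensive.

Import Order.TTheory GRing.Theory Num.Theory.
Import numFieldNormedType.Exports.

Local Open Scope classical_set_scope.
Local Open Scope ring_scope.

Definition l2norm (R : realType) (m : nat) (v : 'cV[R]_m) : R :=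
  Num.sqrt (\sum_(i < m) v i 0 ^+ 2).

Definition signings (R : realType) (n : nat) : set 'cV[R]_n :=
  [set x | forall j, x j 0 = 1 \/ x j 0 = -1].

(* [mx_norm] of a column vector is its l_infinity norm (0 if it is empty).
   The infimum is over a finite nonempty set, hence a minimum: see [disc_min]
   and [disc_le]. *)
Definition disc (R : realType) (m n : nat) (A : 'M[R]_(m, n)) : R :=
  inf [set mx_norm (A *m x) | x in @signings R n].

Lemma disc_le (R : realType) (m n : nat) (A : 'M[R]_(m, n)) (x : 'cV[R]_n) :
  signings x -> disc A <= mx_norm (A *m x).
Proof.
move=> sx; apply: ge_inf; last by exists x.
by exists 0 => _ [y _ <-]; rewrite /mx_norm.
Qed.

Lemma disc_min (R : realType) (m n : nat) (A : 'M[R]_(m, n)) :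
  exists2 x, signings x & disc A = mx_norm (A *m x).
Proof.
pose sg (s : {ffun 'I_n -> bool}) : 'cV[R]_n := \col_j (-1) ^+ s j.
have sgP s : signings (sg s).
  by move=> j; rewrite mxE; case: (s j); [right; rewrite expr1|left; rewrite expr0].
have sg_onto x : signings x -> exists s, x = sg s.
  move=> sx; exists [ffun j => x j 0 != 1].
  apply/matrixP => j k; rewrite !mxE ffunE ord1.
  by case: eqVneq (sx j) => [->|/eqP + [//|->]].
pose s0 := [arg min_(s < [ffun=> false] : {ffun 'I_n -> bool})
              mx_norm (A *m sg s)]%O.
exists (sg s0) => //; apply/eqP; rewrite eq_le disc_le //=.
apply: lb_le_inf; first by exists (mx_norm (A *m sg s0)); exists (sg s0).
move=> _ [y /sg_onto[s ->] <-]; rewrite /s0.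
by case: arg_minP => // i _; apply.
Qed.

(* Main.v *)
Require Import Defs.
From mathcomp Require Import all_boot all_order all_algebra.
From mathcomp Require Import all_classical all_reals all_analysis.
From mathcomp Require Import ring lra.

Import Order.TTheory GRing.Theory Num.Theory.
Import numFieldNormedType.Exports.

Local Open Scope ring_scope.

(** A deterministic rounding of a fractional vector [x], started at 0, in which
every coordinate is frozen on reaching 1 or -1.  A row is not allowed to move
while its alive part has squared norm above 8; afterwards it passes through
about log log n stages, in each of which the squared norm of its alive part
halves and only its entries below a cutoff are followed.  Entries above the
cutoff cost little, since their l1-norm is at most (squared norm) / cutoff: this
is where log^(1/4) n comes from.

The discrepancy d and the energy s = sum_j a_j^2 (1 - x_j^2) of the followed part
of a row enter through Y = sqrt(1 + (mu d)^2) - 1 + 16 mu^2 s.  For every column j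
and stage, exp(theta sum_i a_ij^2 Y_i) is one summand of a potential that never
increases.  Hence in every column the rows with large d carry only a small part
of the squared mass, so that there are few of them compared with the number of
alive columns, and they can be kept from moving any further.

At a minimiser of the potential under these constraints, a second-order expansion
shows that some coordinate must be frozen.  Otherwise there is a direction
orthogonal to all tight rows along which the second derivative is negative: the
squared differential of each exponent has to be compared with its diagonal part,
and a quadratic form exceeds a multiple C of its diagonal only on few directions,
by a trace bound.  Applied to the forms in the rows this decouples the
contributions of different rows; applied to the forms in the columns it bounds
squared row increments by sums of squares.  Only the weights given by the current
potential matter, so that no semidefinite duality is needed. *)

Set Implicit Arguments.
Unset Strict Implicit.

(** * Quadratic forms off few directions *)

Section LinearAlgebra.
Variable R : realType.

Lemma sum_sqr_proj (I : finType) (w e : I -> R) : \sum_i e i ^+ 2 = 1 ->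
  \sum_i (w i - (\sum_l w l * e l) * e i) ^+ 2 =
  \sum_i w i ^+ 2 - (\sum_i w i * e i) ^+ 2.
Proof.
move=> e1; set s := \sum_l w l * e l.
have sqE i : (w i - s * e i) ^+ 2 =
  w i ^+ 2 - s *+ 2 * (w i * e i) + s ^+ 2 * e i ^+ 2 by ring.
rewrite (eq_bigr _ (fun i _ => sqE i)).
by rewrite big_split/= sumrB -!mulr_sumr e1 -/s; ring.
Qed.

(* Greedy: as long as a unit vector [e] violates the bound, replace each [w t]
   by its projection orthogonal to [e]; this lowers the total squared length by
   more than [C]. *)
Lemma quadratic_form_bounded_off_few (T I : finType) (w : T -> I -> R) (C : R) :
  0 < C ->
  exists S : seq {ffun I -> R},
    (size S)%:R * C <= \sum_t \sum_i w t i ^+ 2 /\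
    forall y : I -> R, (forall e, e \in S -> \sum_i e i * y i = 0) ->
      \sum_t (\sum_i w t i * y i) ^+ 2 <= C * \sum_i y i ^+ 2.
Proof.
move=> C0.
have w0 (w' : T -> I -> R) : 0 <= \sum_t \sum_i w' t i ^+ 2.
  by apply: sumr_ge0 => t _; apply: sumr_ge0 => i _; exact: sqr_ge0.
(* [N] bounds the trace divided by [C]; each projection lowers this ratio by more than 1. *)
suff H N : forall w : T -> I -> R, \sum_t \sum_i w t i ^+ 2 < N%:R * C ->
    exists S : seq {ffun I -> R},
    (size S)%:R * C <= \sum_t \sum_i w t i ^+ 2 /\
    forall y : I -> R, (forall e, e \in S -> \sum_i e i * y i = 0) ->
      \sum_t (\sum_i w t i * y i) ^+ 2 <= C * \sum_i y i ^+ 2.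
  pose x := (\sum_t \sum_i w t i ^+ 2) / C.
  apply: (H (Num.truncn x).+1 w); rewrite -ltr_pdivrMr// -/x.
  exact: truncnS_gt.
elim: N => [|N IH] {}w wN.
  by move: (w0 w); rewrite leNgt (lt_le_trans wN)// mul0r.
have [|] := pselect (forall y : I -> R,
  \sum_t (\sum_i w t i * y i) ^+ 2 <= C * \sum_i y i ^+ 2).
  by move=> H; exists [::]; rewrite mul0r.
move=> /existsNP[y /negP]; rewrite -ltNge => yC.
pose q := \sum_i y i ^+ 2.
have q0 : 0 < q.
  rewrite lt_neqAle sumr_ge0 ?andbT; last by move=> *; exact: sqr_ge0.
  apply/eqP => q0; move: yC; rewrite -/q -q0 mulr0.
  rewrite big1 ?ltxx// => t _; rewrite big1 ?expr0n// => i _.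
  have /eqP := esym q0; rewrite psumr_eq0; last by move=> *; exact: sqr_ge0.
  by move=> /allP/(_ i); rewrite mem_index_enum sqrf_eq0 => /(_ isT)/eqP ->; rewrite mulr0.
pose e := [ffun i => y i / Num.sqrt q].
have sq : Num.sqrt q ^+ 2 = q by rewrite sqr_sqrtr// ltW.
have e1 : \sum_i e i ^+ 2 = 1.
  under eq_bigr do rewrite ffunE expr_div_n sq.
  by rewrite -mulr_suml divff// gt_eqF.
have we t : (\sum_i w t i * e i) ^+ 2 = (\sum_i w t i * y i) ^+ 2 / q.
  under eq_bigr do rewrite ffunE mulrA.
  by rewrite -mulr_suml expr_div_n sq.
have eC : C < \sum_t (\sum_i w t i * e i) ^+ 2.
  by under eq_bigr do rewrite we; rewrite -mulr_suml ltr_pdivlMr.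
pose w' t i := w t i - (\sum_l w t l * e l) * e i.
have w'E : \sum_t \sum_i w' t i ^+ 2 =
    \sum_t \sum_i w t i ^+ 2 - \sum_t (\sum_i w t i * e i) ^+ 2.
  by rewrite -sumrB; apply: eq_bigr => t _; rewrite sum_sqr_proj.
have [|S [SC Sw]] := IH w'.
  by rewrite w'E; move: wN; rewrite -natr1; lra.
exists (e :: S); split; first by rewrite /= -natr1; lra.
move=> z zS; have ze : \sum_i e i * z i = 0 by apply: zS; rewrite mem_head.
suff <- : \sum_t (\sum_i w' t i * z i) ^+ 2 = \sum_t (\sum_i w t i * z i) ^+ 2.
  by apply: Sw => e' e'S; apply: zS; rewrite inE e'S orbT.
apply: eq_bigr => t _; congr (_ ^+ 2).
under eq_bigr do rewrite mulrBl -mulrA.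
by rewrite sumrB -mulr_sumr ze mulr0 subr0.
Qed.

(* After rescaling to unit diagonal the form has trace at most [#|A|]. *)
Lemma quadratic_form_le_diag_off_few (T I : finType) (A : {set I})
    (f : T -> R) (w : T -> I -> R) (C : R) :
  0 < C -> (forall t, 0 <= f t) ->
  exists S : seq {ffun I -> R},
    (size S)%:R * C <= #|A|%:R /\
    forall y : I -> R, (forall e, e \in S -> \sum_(i in A) e i * y i = 0) ->
      \sum_t f t * (\sum_(i in A) w t i * y i) ^+ 2 <=
      C * \sum_(i in A) (\sum_t f t * w t i ^+ 2) * y i ^+ 2.
Proof.
move=> C0 f0.
pose D i := \sum_t f t * w t i ^+ 2.
have D0 i : 0 <= D i by apply: sumr_ge0 => t _; rewrite mulr_ge0// sqr_ge0.
pose u t i := if i \in A then Num.sqrt (f t) * w t i / Num.sqrt (D i) else 0.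
have [S [SC Su]] := quadratic_form_bounded_off_few u C0.
exists [seq [ffun i => e i * Num.sqrt (D i)] | e : {ffun I -> R} <- S]; split.
  rewrite size_map (le_trans SC)// exchange_big/=.
  rewrite (bigID (mem A))/= [X in _ + X]big1 ?addr0; last first.
    move=> i /negbTE iA; rewrite big1// => t _.
    by rewrite /u iA expr0n.
  rewrite -sum1_card natr_sum; apply: ler_sum => i iA.
  under eq_bigr do rewrite /u iA expr_div_n exprMn !sqr_sqrtr//.
  rewrite -mulr_suml -/(D i).
  by have [->|?] := eqVneq (D i) 0; rewrite ?mul0r// divff.
move=> y Sy.
pose z i := if i \in A then Num.sqrt (D i) * y i else 0.
have := Su z; rewrite (_ : \sum_t _ = \sum_t f t * (\sum_(i in A) w t i * y i) ^+ 2).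
  rewrite (_ : \sum_i z i ^+ 2 = \sum_(i in A) (\sum_t f t * w t i ^+ 2) * y i ^+ 2).
    apply => e eS; rewrite -[RHS](Sy [ffun i => e i * Num.sqrt (D i)]); last first.
      by apply/mapP; exists e.
    rewrite [RHS]big_mkcond; apply: eq_bigr => i _; rewrite /z ffunE.
    by case: ifP; rewrite ?mulr0 ?mulrA.
  rewrite [RHS]big_mkcond; apply: eq_bigr => i _; rewrite /z.
  by case: ifP; rewrite ?expr0n// exprMn sqr_sqrtr.
apply: eq_bigr => t _.
rewrite -[f t in RHS]sqr_sqrtr// -exprMn mulr_sumr [in RHS]big_mkcond/=.
congr (_ ^+ 2); apply: eq_bigr => i _; rewrite /u /z.
case: ifP => iA; rewrite ?mul0r//.
(* Where [D i = 0] the division in [u] returns 0. This is consistent, since then every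
   [f t * w t i ^+ 2] vanishes. *)
have [Di|Di] := eqVneq (D i) 0; last first.
  have : Num.sqrt (D i) != 0 by rewrite sqrtr_eq0 -ltNge lt_neqAle eq_sym Di D0.
  by move=> ?; field.
have : f t * w t i ^+ 2 == 0.
  move/eqP: Di; rewrite psumr_eq0; last by move=> ? _; rewrite mulr_ge0// sqr_ge0.
  by move=> /allP/(_ t); rewrite mem_index_enum => /(_ isT).
rewrite mulf_eq0 sqrf_eq0 => /orP[] /eqP ->.
  by rewrite sqrtr0 !mul0r.
by rewrite !(mulr0, mul0r).
Qed.

Lemma exists_kernel_vector (I : finType) (V : {set I}) (S : seq {ffun I -> R}) :
  (size S < #|V|)%N ->
  exists v : I -> R, [/\ exists i, v i != 0, forall i, i \notin V -> v i = 0 &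
    forall e, e \in S -> \sum_i e i * v i = 0].
Proof.
move=> SV.
pose B : 'M[R]_(#|V|, size S) := \matrix_(a, b) (tnth (in_tuple S) b) (enum_val a).
have : kermx B != 0.
  rewrite -mxrank_eq0 mxrank_ker subn_eq0 -ltnNge.
  exact: leq_ltn_trans (rank_leq_col B) SV.
move=> /rowV0Pn[u /sub_kermxP uB u0].
pose v i := \sum_(a < #|V|) u 0 a * (enum_val a == i)%:R.
have vE a : v (enum_val a) = u 0 a.
  rewrite /v (bigD1 a)//= eqxx mulr1 big1 ?addr0// => b ba.
  by rewrite (inj_eq enum_val_inj) (negbTE ba) mulr0.
have vV i : i \notin V -> v i = 0.
  move=> iV; rewrite /v big1// => a _.
  have [ai|] := eqVneq; last by rewrite mulr0.
  by move: iV; rewrite -ai enum_valP.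
exists v; split => //.
  have [/existsP[a ua]|] := boolP [exists a, u 0 a != 0].
    by exists (enum_val a); rewrite vE.
  rewrite negb_exists => /forallP H; case/eqP: u0.
  by apply/rowP => a; rewrite mxE; apply/eqP; rewrite -[_ == _]negbK H.
move=> e /(nthP e)[b bS <-].
have /rowP/(_ (Ordinal bS)) := uB; rewrite !mxE => uB0; rewrite -[RHS]uB0.
rewrite (bigID (mem V))/= [X in _ + X]big1 ?addr0; last first.
  by move=> i /vV ->; rewrite mulr0.
rewrite big_enum_val/=; apply: eq_bigr => a _.
by rewrite vE mxE mulrC (tnth_nth e)/=.
Qed.

End LinearAlgebra.

(** * Elementary inequalities *)

Section Elementary.
Variable R : realType.
Implicit Types x y z u : R.

(** Both signs rest on [exp u <= 1 / (1 - u)], taken at [z] if [z <= 0] and at [z / 2] otherwise. In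
    the second case [(1 + z + z^2) (1 - z/2)^2 - 1 = z^2 (1 - 3z + z^2) / 4], hence the range
    1/3. *)
Lemma expR_le_quadratic z : `|z| <= 3^-1 -> expR z <= 1 + z + z ^+ 2.
Proof.
rewrite ler_norml => /andP[z1 z2].
have [z0|z0] := leP z 0.
  have := expR_ge1Dx (- z); have := expRxMexpNx_1 z.
  move: (expR z) (expR_gt0 z) (expR (- z)) => e e0 e' ee'.
  by nra.
have := expR_ge1Dx (- (z / 2)); have := expRxMexpNx_1 (z / 2).
have -> : expR z = expR (z / 2) ^+ 2 by rewrite expr2 -expRD; congr expR; lra.
move: (expR (z / 2)) (expR_gt0 (z / 2)) (expR (- (z / 2))) => e e0 e' ee' e'z.
have h0 : 0 < 1 - z / 2 by lra.
have eh : e * (1 - z / 2) <= 1 by nra.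
have eh2 : e ^+ 2 * (1 - z / 2) ^+ 2 <= 1.
  by rewrite -exprMn expr_le1// mulr_ge0// ltW.
have h1 : 1 <= (1 + z + z ^+ 2) * (1 - z / 2) ^+ 2.
  rewrite -subr_ge0 (_ : _ - 1 = z ^+ 2 / 4 * ((1 - z *+ 3) + z ^+ 2)); last by field.
  by rewrite mulr_ge0//; [rewrite divr_ge0// sqr_ge0|rewrite addr_ge0 ?sqr_ge0//; lra].
rewrite -(ler_pM2r (exprn_gt0 2 h0)); exact: le_trans eh2 h1.
Qed.

(** The second derivative of [sqrt (1 + y^2)] is at most 1. The proof squares the tangent bound
    [sqrt (s^2 + h) <= s + h / (2s)] with [h = 2yu + u^2], then uses [s >= 1]. *)
Lemma sqrt1D_sqr_le y u :
  Num.sqrt (1 + (y + u) ^+ 2) <=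
  Num.sqrt (1 + y ^+ 2) + y / Num.sqrt (1 + y ^+ 2) * u + u ^+ 2 / 2.
Proof.
set s := Num.sqrt (1 + y ^+ 2).
have s2 : s ^+ 2 = 1 + y ^+ 2 by rewrite sqr_sqrtr// addr_ge0// sqr_ge0.
have s1 : 1 <= s by rewrite -sqrtr1 ler_wsqrtr// lerDl sqr_ge0.
have s0 : 0 < s by lra.
have key : Num.sqrt (1 + (y + u) ^+ 2) <= s + (y * u + u ^+ 2 / 2) / s.
  have h : 0 <= s + (y * u + u ^+ 2 / 2) / s.
    rewrite -[X in X + _](mulfK (lt0r_neq0 s0)) -mulrDl divr_ge0 ?ltW//.
    by nra.
  rewrite -(ger0_norm h) -sqrtr_sqr ler_wsqrtr//.
  have -> : (s + (y * u + u ^+ 2 / 2) / s) ^+ 2 =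
      s ^+ 2 + (2 * (y * u) + u ^+ 2) + ((y * u + u ^+ 2 / 2) / s) ^+ 2.
    by field; rewrite lt0r_neq0.
  by rewrite s2; have := sqr_ge0 ((y * u + u ^+ 2 / 2) / s); lra.
apply: (le_trans key).
rewrite -addrA lerD2l mulrDl mulrAC lerD2l.
by rewrite ler_pdivrMr// ler_peMr// divr_ge0// sqr_ge0.
Qed.

(** The terms odd in [s] cancel between the two signs, those in [s^2] sum to at most 0 by
    hypothesis, and the rest is of order [s^4]. *)
Lemma sum_expR_pm_lt (T : finType) (f P Q : T -> R) (d : R) :
  0 < d -> (forall t, 0 <= f t) -> \sum_t f t * (Q t + P t ^+ 2) <= 0 ->
  exists2 s0, 0 < s0 & forall s, 0 < s <= s0 ->
    \sum_t f t * (expR (s * P t + s ^+ 2 * Q t) + expR (- s * P t + s ^+ 2 * Q t))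
    < 2 * \sum_t f t + 2 * (s ^+ 2 * d).
Proof.
move=> d0 f0 fPQ.
pose S := \sum_t (`|P t| + `|Q t|); pose U := \sum_t f t * Q t ^+ 2.
have U0 : 0 <= U by apply: sumr_ge0 => t _; rewrite mulr_ge0// sqr_ge0.
have S0 : 0 <= S by apply: sumr_ge0 => t _; rewrite addr_ge0.
have Ud0 : 0 <= U / d by rewrite divr_ge0// ltW.
(* For [s <= 1 / K], the summand [3 * S] keeps all exponents within 1/3 and [U / d] makes [s^4 U]
   smaller than [s^2 d]. *)
pose K := 1 + 3 * S + U / d.
have K1 : 1 <= K by rewrite /K; lra.
have K0 : 0 < K by lra.
exists K^-1; first by rewrite invr_gt0.
move=> s /andP[s0 sK].
have {}sK : s * K <= 1 by rewrite -ler_pdivlMr// mul1r.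
have s1 : s <= 1 by nra.
have sS : s * S <= 3^-1 by move: sK; rewrite /K; nra.
have sU : s ^+ 2 * U < d.
  apply: (@le_lt_trans _ _ (s * U)).
    by rewrite expr2 -mulrA ler_piMl// mulr_ge0// ltW.
  have h : s * (U / d) < 1 by apply: lt_le_trans sK; rewrite ltr_pM2l // /K; lra.
  by rewrite -[U](divfK (lt0r_neq0 d0)) mulrA gtr_pMl.
have small t e : `|e| = s -> `|e * P t + s ^+ 2 * Q t| <= 3^-1.
  move=> es; rewrite (le_trans (ler_normD _ _))// normrM es normrM.
  rewrite (ger0_norm (ltW (exprn_gt0 2 s0)))//.
  apply: le_trans sS.
  rewrite /S (bigD1 t)//= mulrDr mulrDr -addrA lerD2l.
  apply: (@le_trans _ _ (s * `|Q t|)).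
    by rewrite expr2 -mulrA ler_piMl// mulr_ge0// ltW.
  by rewrite lerDl mulr_ge0// ?(ltW s0)// sumr_ge0// => *; rewrite addr_ge0.
have le1 t : f t * (expR (s * P t + s ^+ 2 * Q t) + expR (- s * P t + s ^+ 2 * Q t))
   <= 2 * f t + (2 * s ^+ 2) * (f t * (Q t + P t ^+ 2)) + (2 * s ^+ 4) * (f t * Q t ^+ 2).
  have h1 := expR_le_quadratic (small t s (ger0_norm (ltW s0))).
  have h2 : `|- s| = s by rewrite normrN ger0_norm// ltW.
  have {}h2 := expR_le_quadratic (small t _ h2).
  have := lerD h1 h2; move=> /(ler_wpM2l (f0 t))/le_trans; apply.
  by rewrite le_eqVlt; apply/orP; left; apply/eqP; ring.
apply: (le_lt_trans (ler_sum _ (fun t _ => le1 t))).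
rewrite !big_split/= -!mulr_sumr -/U -addrA ltrD2l.
have s20 : 0 < s ^+ 2 by rewrite exprn_gt0.
have : s ^+ 2 * (s ^+ 2 * U) < s ^+ 2 * d by rewrite ltr_pM2l.
have : s ^+ 2 * \sum_t f t * (Q t + P t ^+ 2) <= 0 by rewrite pmulr_rle0.
rewrite (_ : s ^+ 4 = s ^+ 2 * s ^+ 2); last by ring.
rewrite -!mulrA; lra.
Qed.

Lemma exists_uniform_step (T : finType) (P : T -> R -> Prop) :
  (forall t, exists2 s0, 0 < s0 & forall s, 0 < s <= s0 -> P t s) ->
  exists2 s0, 0 < s0 & forall s, 0 < s <= s0 -> forall t, P t s.
Proof.
move=> H; pose g t := projT1 (cid2 (H t)).
have g0 t : 0 < g t by rewrite /g; case: cid2.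
have gP t s : 0 < s <= g t -> P t s by rewrite /g; case: cid2 => x ? /= h; exact: h.
exists (\big[Order.min/1]_t g t).
  by apply: (big_ind (fun x => 0 < x)) => // x y x0 y0; rewrite lt_min x0.
move=> s /andP[s0 sg] t; apply: gP; rewrite s0 (le_trans sg)//.
exact: bigmin_le_cond.
Qed.

Lemma norm_perturb (y z r : R) : `|y| < r -> exists2 s0, 0 < s0 &
  forall s, 0 < s <= s0 -> `|y + s * z| <= r /\ `|y + (- s) * z| <= r.
Proof.
move=> yr; have z1 : 0 < 1 + `|z| by rewrite ltr_pwDl.
exists ((r - `|y|) / (1 + `|z|)); first by rewrite divr_gt0// subr_gt0.
move=> s /andP[s0]; rewrite ler_pdivlMr// mulrDr mulr1 => sr.
have h e : `|e| = s -> `|y + e * z| <= r.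
  by move=> es; rewrite (le_trans (ler_normD _ _))// normrM es; lra.
by split; apply: h; rewrite ?normrN gtr0_norm.
Qed.

End Elementary.

(** * The potential *)

Section Continuity.
Variables (R : realType) (X : topologicalType).
Implicit Types f g : X -> R.
Lemma continuous_mulf f g : continuous f -> continuous g -> continuous (fun x => f x * g x).
Proof. by move=> cf cg x; apply: continuousM; [exact: cf|exact: cg]. Qed.
Lemma continuous_addf f g : continuous f -> continuous g -> continuous (fun x => f x + g x).
Proof. by move=> cf cg x; apply: continuousD; [exact: cf|exact: cg]. Qed.
Lemma continuous_subf f g : continuous f -> continuous g -> continuous (fun x => f x - g x).
Proof. by move=> cf cg x; apply: continuousB; [exact: cf|exact: cg]. Qed.
Lemma continuous_constf (c : R) : continuous (fun x : X => c).
Proof. exact: cst_continuous. Qed.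
Lemma continuous_sumf (J : finType) (h : J -> X -> R) :
  (forall j, continuous (h j)) -> continuous (fun x : X => \sum_j h j x).
Proof.
move=> hc; apply: continuous_big => [|j _]; last exact: hc.
by move=> u; exact: add_continuous.
Qed.
Lemma continuous_compf f (h : R -> R) :
  continuous f -> continuous h -> continuous (fun x => h (f x)).
Proof. by move=> cf ch x; apply: (@continuous_comp _ _ _ f h); [exact: cf|exact: ch]. Qed.
End Continuity.

Section Potential.
Variables (R : realType) (n : nat) (I T : finType).
Variables (A : nat -> I -> 'I_n -> R) (mu cap : nat -> R).
Variables (st : T -> nat) (cf : T -> I -> R) (kap : T -> R) (eta : R).

Implicit Types (x v : 'rV[R]_n) (s : R) (t : T) (w : 'I_n -> R).

Definition dot (w : 'I_n -> R) (x : 'rV[R]_n) : R := \sum_j w j * x 0 j.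

Definition sqdot (w : 'I_n -> R) (x v : 'rV[R]_n) : R :=
  \sum_j w j ^+ 2 * (x 0 j * v 0 j).

Definition row_energy k i (o : R) (x : 'rV[R]_n) : R :=
  Num.sqrt (1 + (mu k * (dot (A k i) x - o)) ^+ 2) - 1
  + 16 * mu k ^+ 2 * \sum_j A k i j ^+ 2 * (1 - x 0 j ^+ 2).

(* A row that has not reached stage [k] counts with the largest energy it can
   have on entering, so that changing stage never increases a test. *)
Definition stage_energy (p : I -> nat) (o : I -> R) x k i : R :=
  if (p i < k)%N then cap k else
  if p i == k then row_energy k i (o i) x else 0.

Definition test (p : I -> nat) (o : I -> R) x t : R :=
  \sum_i cf t i * stage_energy p o x (st t) i - kap t.

(* The last term turns weak descent along a nonzero direction into strict descent. *)
Definition potential p o x : R :=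
  \sum_t expR (test p o x t) - eta * \sum_j x 0 j ^+ 2.

Lemma dotDZ w x s v : dot w (x + s *: v) = dot w x + s * dot w v.
Proof.
rewrite /dot mulr_sumr -big_split/=; apply: eq_bigr => j _.
by rewrite !mxE; ring.
Qed.

Lemma sum_sqrDZ w x s v :
  \sum_j w j ^+ 2 * (1 - (x + s *: v) 0 j ^+ 2) =
  \sum_j w j ^+ 2 * (1 - x 0 j ^+ 2) - s * (2 * sqdot w x v)
  - s ^+ 2 * \sum_j w j ^+ 2 * v 0 j ^+ 2.
Proof.
rewrite /sqdot !mulr_sumr -!sumrB; apply: eq_bigr => j _.
by rewrite !mxE; ring.
Qed.

(* [slope] is the derivative of [row_energy] along [v]; [curvature] only bounds
   its second-order term, see [row_energy_step]. *)
Definition slope k i o x v : R :=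
  let y := mu k * (dot (A k i) x - o) in
  mu k * (y / Num.sqrt (1 + y ^+ 2)) * dot (A k i) v
  - 32 * mu k ^+ 2 * sqdot (A k i) x v.

Definition curvature k i v : R :=
  mu k ^+ 2 * dot (A k i) v ^+ 2 / 2
  - 16 * mu k ^+ 2 * \sum_j A k i j ^+ 2 * v 0 j ^+ 2.

Lemma row_energy_step k i o x s v :
  row_energy k i o (x + s *: v) <=
  row_energy k i o x + s * slope k i o x v + s ^+ 2 * curvature k i v.
Proof.
rewrite /row_energy /slope /curvature sum_sqrDZ dotDZ.
have -> : mu k * (dot (A k i) x + s * dot (A k i) v - o) =
  mu k * (dot (A k i) x - o) + s * mu k * dot (A k i) v by ring.
have := sqrt1D_sqr_le (mu k * (dot (A k i) x - o)) (s * mu k * dot (A k i) v).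
set y := mu k * _; set r := y / _; set q := Num.sqrt (1 + y ^+ 2).
set d := dot _ v; set S := \sum_j _ * (1 - _); set U := \sum_j _ * v _ _ ^+ 2.
set W := sqdot _ _ _ => h.
apply: le_trans (_ : (q + r * (s * mu k * d) + (s * mu k * d) ^+ 2 / 2) - 1 +
   16 * mu k ^+ 2 * (S - s * (2 * W) - s ^+ 2 * U) <= _); first by lra.
rewrite le_eqVlt; apply/orP; left; apply/eqP; by field.
Qed.

(** By [(b - c)^2 <= 2b^2 + 2c^2], as [y / sqrt (1 + y^2)] is at most 1 in absolute value; 2048 is
    [2 * 32^2]. *)
Lemma slope_sqr_le k i o x v :
  slope k i o x v ^+ 2 <= 2 * mu k ^+ 2 * dot (A k i) v ^+ 2
                          + 2048 * mu k ^+ 4 * sqdot (A k i) x v ^+ 2.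
Proof.
rewrite /slope; set y := mu k * (_ - o).
set r := y / _; set d := dot _ v; set W := sqdot _ _ _.
have r1 : r ^+ 2 <= 1.
  rewrite /r expr_div_n sqr_sqrtr ?addr_ge0 ?sqr_ge0//.
  by rewrite ler_pdivrMr ?mul1r ?lerDr// ltr_pwDl// sqr_ge0.
have h : (mu k * r * d) ^+ 2 <= mu k ^+ 2 * d ^+ 2.
  rewrite (_ : (mu k * r * d) ^+ 2 = r ^+ 2 * (mu k ^+ 2 * d ^+ 2)); last by ring.
  by rewrite ler_piMl// mulr_ge0 ?sqr_ge0.
have := sqr_ge0 (mu k * r * d + 32 * mu k ^+ 2 * W).
move: h; set z := mu k * r * d; set u := 32 * _ * W.
have -> : 2048 * mu k ^+ 4 * W ^+ 2 = 2 * u ^+ 2 by rewrite /u; ring.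
by rewrite sqrrD sqrrB !mulr2n -!mulrA; lra.
Qed.

Section Descent.
Variables (p : I -> nat) (o : I -> R) (x v : 'rV[R]_n).
Hypothesis cf0 : forall t i, 0 <= cf t i.
Hypothesis eta0 : 0 < eta.
Hypothesis v0 : exists j, v 0 j != 0.
Let f t := expR (test p o x t).
Let g i := slope (p i) i (o i) x v.
Let q i := curvature (p i) i v.
Let omega i := \sum_(t | p i == st t) f t * cf t i.
Hypothesis decoupled : \sum_t f t * (\sum_(i | p i == st t) cf t i * g i) ^+ 2 <=
  \sum_t f t * \sum_(i | p i == st t) cf t i * g i ^+ 2.
Hypothesis spread :
  \sum_i omega i * (5 / 2 * mu (p i) ^+ 2 * dot (A (p i) i) v ^+ 2
    + 2048 * mu (p i) ^+ 4 * sqdot (A (p i) i) x v ^+ 2) <=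
  \sum_i omega i * (16 * mu (p i) ^+ 2 * \sum_j A (p i) i j ^+ 2 * v 0 j ^+ 2).

Lemma test_step s t :
  test p o (x + s *: v) t <= test p o x t +
    (s * (\sum_(i | p i == st t) cf t i * g i)
     + s ^+ 2 * (\sum_(i | p i == st t) cf t i * q i)).
Proof.
rewrite /test -addrA [- _ + _]addrC addrA lerD2r.
rewrite !mulr_sumr [X in _ <= _ + (X + _)]big_mkcond.
rewrite [X in _ <= _ + (_ + X)]big_mkcond -!big_split/=.
apply: ler_sum => i _; rewrite /stage_energy.
case: ltnP => ist; first by rewrite ltn_eqF// !addr0.
case: eqP => [pst|_]; last by rewrite !addr0.
have := ler_wpM2l (cf0 t i) (row_energy_step (st t) i (o i) x s v).
by rewrite /g /q pst => /le_trans; apply; rewrite le_eqVlt; apply/orP; left; apply/eqP; ring.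
Qed.

(** After [decoupled], row [i] contributes its curvature plus its squared slope, with total weight
    [omega i]. By [slope_sqr_le] these sums are controlled by the two sides of [spread]; 5/2 is 1/2
    from the curvature plus 2 from the slope. *)
Lemma sum_second_order_le0 : \sum_t f t * (\sum_(i | p i == st t) cf t i * q i +
  (\sum_(i | p i == st t) cf t i * g i) ^+ 2) <= 0.
Proof.
under eq_bigr do rewrite mulrDr.
rewrite big_split/=.
apply: (le_trans (lerD (lexx _) decoupled)).
rewrite -big_split/=.
have -> : \sum_t (f t * (\sum_(i | p i == st t) cf t i * q i) +
    f t * (\sum_(i | p i == st t) cf t i * g i ^+ 2)) =
    \sum_i omega i * (q i + g i ^+ 2).
  under [RHS]eq_bigr do rewrite mulr_suml.
  rewrite (exchange_big_dep predT)//=; apply: eq_bigr => t _.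
  by rewrite -mulrDr -big_split mulr_sumr/=; apply: eq_bigr => i _; ring.
have omega0 i : 0 <= omega i by apply: sumr_ge0 => t _; rewrite mulr_ge0// expR_ge0.
have := spread; rewrite -subr_ge0 => sp.
rewrite -oppr_ge0 (le_trans sp)// -sumrB -sumrN; apply: ler_sum => i _.
rewrite -mulrBr -mulrN ler_wpM2l//.
have := slope_sqr_le (p i) i (o i) x v; rewrite -/(g i) /q /curvature.
by lra.
Qed.

(** The exponentials gain less than [2 s^2 eta d] in total, with [d] the squared length of [v], and
    the subtracted quadratic term takes away exactly this amount. *)
Lemma potential_descent : exists2 s0, 0 < s0 & forall s, 0 < s <= s0 ->
  potential p o (x + s *: v) + potential p o (x + (- s) *: v) < 2 * potential p o x.
Proof.
have [j vj] := v0.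
pose d := \sum_j v 0 j ^+ 2.
have d0 : 0 < d.
  rewrite /d (bigD1 j)//= ltr_pwDl//; last by apply: sumr_ge0 => *; exact: sqr_ge0.
  by rewrite lt_neqAle eq_sym sqrf_eq0 vj sqr_ge0.
have [s0 s00 H] := sum_expR_pm_lt (mulr_gt0 eta0 d0) (fun t => expR_ge0 _) sum_second_order_le0.
exists s0 => // s /H; rewrite /potential -/f => {}H.
have le t e : expR (test p o (x + e *: v) t) <= f t *
   expR (e * (\sum_(i | p i == st t) cf t i * g i)
     + e ^+ 2 * (\sum_(i | p i == st t) cf t i * q i)).
  by rewrite /f -expRD ler_expR test_step.
have {le} le : \sum_t expR (test p o (x + s *: v) t)
    + \sum_t expR (test p o (x + (- s) *: v) t) < 2 * \sum_t f t + 2 * (s ^+ 2 * (eta * d)).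
  apply: le_lt_trans H; rewrite -big_split/=; apply: ler_sum => t _.
  rewrite mulrDr lerD//.
  by have := le t (- s); rewrite sqrrN.
have sq : \sum_j (x + s *: v) 0 j ^+ 2 + \sum_j (x + (- s) *: v) 0 j ^+ 2 =
   2 * \sum_j x 0 j ^+ 2 + 2 * s ^+ 2 * d.
  rewrite /d !mulr_sumr -!big_split/=; apply: eq_bigr => k _.
  by rewrite !mxE; ring.
rewrite addrACA -opprD -mulrDr sq.
rewrite ltrBlDr (lt_le_trans le)// le_eqVlt; apply/orP; left; apply/eqP.
by rewrite -/f; ring.
Qed.

End Descent.

Lemma coord_continuous_rV j : continuous (fun x => x 0 j : R).
Proof. by move=> x; exact: coord_continuous. Qed.

Lemma dot_continuous w : continuous (dot w).
Proof.
apply: continuous_sumf => j; apply: continuous_mulf; first exact: continuous_constf.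
exact: coord_continuous_rV.
Qed.

Lemma sqr_coord_continuous j : continuous (fun x => x 0 j ^+ 2 : R).
Proof. by apply: continuous_mulf; exact: coord_continuous_rV. Qed.

Lemma row_energy_continuous k i o : continuous (row_energy k i o).
Proof.
have h : continuous (fun x => mu k * (dot (A k i) x - o)).
  apply: continuous_mulf; first exact: continuous_constf.
  by apply: continuous_subf; [exact: dot_continuous|exact: continuous_constf].
apply: continuous_addf.
  apply: continuous_subf; last exact: continuous_constf.
  have h1 : continuous (fun x => 1 + (mu k * (dot (A k i) x - o)) ^+ 2).
    by apply: continuous_addf; [exact: continuous_constf|exact: continuous_mulf].
  by apply: continuous_compf; [exact: h1|exact: sqrt_continuous].
apply: continuous_mulf; first exact: continuous_constf.
apply: continuous_sumf => j; apply: continuous_mulf; first exact: continuous_constf.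
by apply: continuous_subf; [exact: continuous_constf|exact: sqr_coord_continuous].
Qed.

Lemma potential_continuous p o : continuous (potential p o).
Proof.
have h t : continuous (fun x => test p o x t).
  apply: continuous_subf; last exact: continuous_constf.
  apply: continuous_sumf => i; apply: continuous_mulf; first exact: continuous_constf.
  rewrite /stage_energy; case: (p i < st t)%N; first exact: continuous_constf.
  by case: (p i == st t); [exact: row_energy_continuous|exact: continuous_constf].
apply: continuous_subf.
  apply: continuous_sumf => t.
  by apply: continuous_compf; [exact: h|exact: continuous_expR].
apply: continuous_mulf; first exact: continuous_constf.
by apply: continuous_sumf => j; exact: sqr_coord_continuous.
Qed.

End Potential.

(** * The walk *)

Section Walk.
Variables (R : realType) (n : nat) (I : finType) (a : I -> 'I_n -> R).
Variables (ell : nat) (lam : R).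

(* In stage [k] a row is followed through its entries of absolute value at most
   [cutoff k]; it may leave the stage once the alive ones have squared norm at most
   [mass k].  Stage 0 rows do not move at all, and stage [ell.+1] is the last. *)
Definition mass k : R := 8 / 2 ^+ k.

Definition cutoff k : R := if k is k'.+1 then mass k' / (512 * lam) else 1.

Definition small_part k i j : R := if `|a i j| <= cutoff k then a i j else 0.

(** The larger rate of the last stage lets the single-row tests bound the discrepancy there
    ([final_disc_lt]). The cutoff of that stage is small enough for rate times cutoff to remain 1/64
    ([rate_cutoff]). *)
Definition rate k : R := if (k <= ell)%N then lam else lam * 2 ^+ ell.

(** On entering a stage the discrepancy is 0, so only the sum of squares counts, and its alive part
    is at most [mass k.-1]. *)
Definition initial_energy k : R := 16 * rate k ^+ 2 * mass k.-1.

(** Plays [C] for the forms of stage [k]. When the stage has at most [#|V| / mass k] rows, at most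
    [#|V| / (8 ell)] directions are given up. *)
Definition spectral_bound k : R := 8 * ell%:R / mass k.

(** Keeps the coefficients of the column tests below [1 / spectral_bound k], which absorbs one
    factor of a squared coefficient in [stage_forms]. *)
Definition temperature k : R := (spectral_bound k * cutoff k ^+ 2)^-1.

(* [inl (k, j)] tests the stage [k.+1] rows through column [j], and [inr i] tests
   row [i] alone in the last stage. *)
Definition tests : Type := ('I_ell * 'I_n + I)%type.

Definition test_stage (t : tests) : nat :=
  match t with inl kj => kj.1.+1 | inr _ => ell.+1 end.

Definition test_coef (t : tests) i : R :=
  match t with
  | inl kj => temperature kj.1.+1 * small_part kj.1.+1 i kj.2 ^+ 2
  | inr i' => (i == i')%:R
  end.

Definition test_offset (t : tests) : R :=
  match t with
  | inl kj => temperature kj.1.+1 * initial_energy kj.1.+1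
  | inr _ => initial_energy ell.+1
  end.

Definition walk_potential :=
  potential small_part rate initial_energy test_stage test_coef test_offset n%:R^-1.

(** A row at this discrepancy has energy at least [264 ell^2 lam^2], half of 528 being given up for
    the [- 1]. This is [8 ell] times the factor [33 ell lam^2] of [stage_budget]. *)
Definition stage_disc : R := 528 * ell%:R ^+ 2 * lam.

Definition radius (k : nat) : R := if k == 0%N then 0 else stage_disc.

Definition stage_cost : R := stage_disc + 1024 * lam.

Definition alive_mass (V : {set 'I_n}) k i : R := \sum_(j in V) small_part k i j ^+ 2.

(* [o i] is the value of the followed part of row [i] when it entered its stage.
   [ws_past] bounds the rest of the row whatever happens to its alive entries. *)
Record walk_state (V : {set 'I_n}) (p : I -> nat) (o : I -> R) (x : 'rV[R]_n) : Prop :=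
 WalkState {
  ws_cube : forall j, `|x 0 j| <= 1;
  ws_frozen : forall j, j \notin V -> `|x 0 j| = 1;
  ws_stage : forall i, (p i <= ell.+1)%N;
  ws_disc : forall i, `|dot (small_part (p i) i) x - o i| <= radius (p i);
  ws_past : forall i (y : 'rV[R]_n), (forall j, `|y 0 j| <= 1) ->
    (forall j, j \notin V -> y 0 j = x 0 j) ->
    `|dot (a i) y - dot (small_part (p i) i) y + o i| <= (p i)%:R * stage_cost;
  ws_mass : forall i, (0 < p i)%N -> alive_mass V (p i) i <= mass (p i).-1;
  ws_potential : walk_potential p o x <= ell%:R * n%:R + #|I|%:R }.

Definition feasible (V : {set 'I_n}) (p : I -> nat) (o : I -> R) (x y : 'rV[R]_n) :=
  [/\ forall j, `|y 0 j| <= 1, forall j, j \notin V -> y 0 j = x 0 j &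
      forall i, `|dot (small_part (p i) i) y - o i| <= radius (p i)].

Hypothesis ell_gt0 : (0 < ell)%N.
Hypothesis lam_ge1 : 1 <= lam.
Hypothesis col_le1 : forall j, \sum_i a i j ^+ 2 <= 1.

Let lam_gt0 : 0 < lam. Proof. exact: lt_le_trans lam_ge1. Qed.

Let lam512_gt0 : 0 < 512 * lam. Proof. by rewrite mulr_gt0 ?lam_gt0 ?ltr0n. Qed.

Lemma mass_gt0 k : 0 < mass k.
Proof. by rewrite divr_gt0// exprn_gt0. Qed.

Lemma massS k : mass k.+1 = mass k / 2.
Proof. by rewrite /mass exprS; field; rewrite expf_neq0. Qed.

Lemma mass_le8 k : mass k <= 8.
Proof.
elim: k => [|k IH]; rewrite ?massS; first by rewrite /mass expr0; lra.
by move: IH (mass_gt0 k); lra.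
Qed.

Lemma cutoff_gt0 k : 0 < cutoff k.
Proof. case: k => [|k]; first exact: ltr01.
by apply: divr_gt0; [exact: mass_gt0|exact: lam512_gt0].
Qed.

Lemma cutoffS_le k : cutoff k.+1 <= cutoff k.
Proof.
rewrite [cutoff k.+1]/cutoff (ler_pdivrMr _ _ lam512_gt0); case: k => [|k].
  by rewrite /mass expr0 /=; move: lam_ge1; lra.
by rewrite /= divfK ?(gt_eqF lam512_gt0)// massS; move: (mass_gt0 k); lra.
Qed.

Lemma entry_le1 i j : `|a i j| <= 1.
Proof.
have : a i j ^+ 2 <= 1.
  apply: le_trans (col_le1 j); rewrite (bigD1 i)//= lerDl.
  by apply: sumr_ge0 => *; exact: sqr_ge0.
by rewrite -real_normK ?num_real// expr_le1.
Qed.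

Lemma small_part0 i j : small_part 0 i j = a i j.
Proof. by rewrite /small_part entry_le1. Qed.

Lemma small_part_le k i j : `|small_part k i j| <= cutoff k.
Proof.
by rewrite /small_part; case: ifP => // _; rewrite normr0 ltW// cutoff_gt0.
Qed.

Lemma small_part_sqr_le k i j : small_part k i j ^+ 2 <= a i j ^+ 2.
Proof. by rewrite /small_part; case: ifP => // _; rewrite expr0n sqr_ge0. Qed.

Lemma small_partS_sqr_le k i j : small_part k.+1 i j ^+ 2 <= small_part k i j ^+ 2.
Proof.
rewrite /small_part; case: ifP => h; last by rewrite expr0n sqr_ge0.
by rewrite (le_trans h (cutoffS_le k)).
Qed.

Lemma rate_gt0 k : 0 < rate k.
Proof. by rewrite /rate; case: ifP => // _; rewrite mulr_gt0// exprn_gt0. Qed.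

Lemma rate_cutoff k : (k <= ell)%N -> rate k.+1 * cutoff k.+1 <= 64^-1.
Proof.
move=> kl; rewrite /rate /cutoff /=.
have l0 := gt_eqF lam_gt0.
case: leqP => [lk|kl1] /=; last first.
  have -> : lam * (mass k / (512 * lam)) = mass k / 512.
    by field; rewrite l0.
  have := mass_le8 k; lra.
have -> : k = ell by apply/eqP; rewrite eqn_leq kl.
have -> : lam * 2 ^+ ell * (mass ell / (512 * lam)) = 64^-1.
  by rewrite /mass; field; rewrite l0 expf_neq0 // pnatr_eq0.
exact: lexx.
Qed.

Lemma initial_energy_ge0 k : 0 <= initial_energy k.
Proof. by rewrite mulr_ge0 ?(ltW (mass_gt0 _))// mulr_ge0// sqr_ge0. Qed.

Lemma spectral_bound_gt0 k : 0 < spectral_bound k.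
Proof. by rewrite divr_gt0 ?mass_gt0// mulr_gt0// ltr0n. Qed.

Lemma temperature_gt0 k : 0 < temperature k.
Proof.
by rewrite invr_gt0 mulr_gt0 ?spectral_bound_gt0// exprn_gt0// cutoff_gt0.
Qed.

Lemma test_coef_ge0 t i : 0 <= test_coef t i.
Proof.
by case: t => [kj|i'] /=; rewrite ?ler0n// mulr_ge0 ?sqr_ge0// ltW// temperature_gt0.
Qed.

Lemma stage_disc_gt0 : 0 < stage_disc.
Proof. by rewrite mulr_gt0 ?lam_gt0 ?mulr_gt0 ?exprn_gt0 ?ltr0n. Qed.

Lemma radius_ge0 k : 0 <= radius k.
Proof. by rewrite /radius; case: ifP => // _; rewrite ltW// stage_disc_gt0. Qed.

Lemma row_energy_ge0 k i z (x : 'rV[R]_n) : (forall j, `|x 0 j| <= 1) ->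
  0 <= row_energy small_part rate k i z x.
Proof.
move=> x1; rewrite addr_ge0//.
  by rewrite subr_ge0 -{1}sqrtr1 ler_wsqrtr// lerDl sqr_ge0.
apply: mulr_ge0; first by apply: mulr_ge0; last exact: sqr_ge0.
apply: sumr_ge0 => j _.
by rewrite mulr_ge0 ?sqr_ge0// subr_ge0 -real_normK ?num_real// expr_le1.
Qed.

Lemma stage_energy_ge0 p o (x : 'rV[R]_n) k i : (forall j, `|x 0 j| <= 1) ->
  0 <= stage_energy small_part rate initial_energy p o x k i.
Proof.
move=> x1; rewrite /stage_energy.
by do 2?case: ifP => // _; [exact: initial_energy_ge0|exact: row_energy_ge0].
Qed.

(** At 0 every row still counts with its cap, so columns of norm at most 1 make all exponents
    nonpositive. The potential is then at most the number of tests. *)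
Lemma walk_state_initial : walk_state [set: 'I_n] (fun=> 0) (fun=> 0) 0.
Proof.
have d0 w : dot w (0 : 'rV[R]_n) = 0.
  by rewrite /dot big1// => j _; rewrite mxE mulr0.
split => //.
- by move=> j; rewrite mxE normr0.
- by move=> j; rewrite inE.
- by move=> i; rewrite d0 subr0 normr0.
- move=> i y _ _; rewrite addr0 mul0r (_ : _ - _ = 0) ?normr0//.
  apply/eqP; rewrite subr_eq0; apply/eqP.
  by apply: eq_bigr => j _; rewrite small_part0.
rewrite /walk_potential /potential [X in _ - _ * X]big1 ?mulr0 ?subr0; last first.
  by move=> j _; rewrite mxE expr0n.
rewrite -natrM -natrD.
have -> : (ell * n + #|I| = #|{: tests}|)%N.
  by rewrite card_sum card_prod !card_ord.
rewrite -sum1_card natr_sum; apply: ler_sum => t _.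
rewrite expR_le1 /test subr_le0.
case: t => [[k j]|i] /=.
  under eq_bigr do rewrite /stage_energy ltn0Sn mulrAC.
  rewrite -mulr_sumr ler_piMr ?(mulr_ge0 (ltW (temperature_gt0 _)) (initial_energy_ge0 _))//.
  by apply: le_trans (col_le1 j); apply: ler_sum => i _; exact: small_part_sqr_le.
rewrite (bigD1 i)//= eqxx mul1r big1 ?addr0.
  by rewrite /stage_energy ltn0Sn.
by move=> i' /negbTE ->; rewrite mul0r.
Qed.

(** A dropped entry exceeds [cutoff k.+1], so the alive dropped entries have l1-norm at most
    [mass k / cutoff k.+1 = 512 lam]; a coordinate changes by at most 2. *)
Lemma dropped_part_le (V : {set 'I_n}) k i (y x : 'rV[R]_n) : (k <= ell)%N ->
  (forall j, `|x 0 j| <= 1) -> (forall j, `|y 0 j| <= 1) ->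
  (forall j, j \notin V -> y 0 j = x 0 j) ->
  alive_mass V k i <= mass k ->
  `|\sum_j (small_part k i j - small_part k.+1 i j) * (y 0 j - x 0 j)|
    <= 1024 * lam.
Proof.
move=> kl x1 y1 yx Vk.
have c0 := cutoff_gt0 k.+1.
rewrite (le_trans (ler_norm_sum _ _ _))//.
have -> : 1024 * lam = 2 * (mass k / cutoff k.+1).
  by rewrite /cutoff; field; rewrite !gt_eqF ?mass_gt0.
apply: (@le_trans _ _ (2 * (alive_mass V k i / cutoff k.+1))); last first.
  by rewrite ler_wpM2l// ler_wpM2r// invr_ge0 ltW.
rewrite /alive_mass mulr_suml mulr_sumr [leRHS]big_mkcond; apply: ler_sum => j _.
case: ifPn => [jV|/yx ->]; last by rewrite subrr mulr0 normr0.
rewrite normrM [leRHS]mulrC ler_pM//; last first.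
  by rewrite (le_trans (ler_normB _ _))//; move: (x1 j) (y1 j); lra.
rewrite ler_pdivlMr// /small_part.
have [h1|h1] := leP `|a i j| (cutoff k); last first.
  have [h2|_] := leP `|a i j| (cutoff k.+1).
    by move: (lt_le_trans h1 h2) (cutoffS_le k); rewrite ltNge => /negbTE ->.
  by rewrite subrr normr0 mul0r sqr_ge0.
have [_|h2] := leP `|a i j| (cutoff k.+1).
  by rewrite subrr normr0 mul0r sqr_ge0.
rewrite subr0 -[leRHS]real_normK ?num_real// expr2 ler_wpM2l//.
exact: ltW.
Qed.

Definition update (T : Type) (f : I -> T) i0 y : I -> T := fun i => if i == i0 then y else f i.

Lemma walk_state_advance V p o x i0 : walk_state V p o x ->
  (p i0 <= ell)%N -> alive_mass V (p i0) i0 <= mass (p i0) ->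
  walk_state V (update p i0 (p i0).+1)
    (update o i0 (dot (small_part (p i0).+1 i0) x)) x.
Proof.
move=> [cube frozen stage disc past massV pot] pl Vm.
split => //.
- by move=> i; rewrite /update; case: eqP.
- move=> i; rewrite /update; case: eqP => [->|_]//.
  by rewrite subrr normr0 radius_ge0.
- move=> i y y1 yx; rewrite /update; case: eqP => [->|_]; last exact: past.
  set k := p i0.
  (* The new past is the old past, the discrepancy of the stage being left, and the effect of the
     dropped entries. *)
  have -> : dot (a i0) y - dot (small_part k.+1 i0) y + dot (small_part k.+1 i0) x =
    (dot (a i0) y - dot (small_part k i0) y + o i0)
    + (dot (small_part k i0) x - o i0)
    + \sum_j (small_part k i0 j - small_part k.+1 i0 j) * (y 0 j - x 0 j).
    rewrite (_ : \sum_j _ = dot (small_part k i0) y - dot (small_part k i0) x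
        - (dot (small_part k.+1 i0) y - dot (small_part k.+1 i0) x)); first by ring.
    by rewrite /dot -!sumrB; apply: eq_bigr => j _; ring.
  rewrite (le_trans (ler_normD _ _))// -natr1 mulrDl mul1r.
  have h1 := dropped_part_le pl cube y1 yx Vm.
  have h2 := past i0 y y1 yx; have h3 := disc i0.
  have h4 : radius (p i0) <= stage_disc.
    by rewrite /radius; case: ifP => // _; rewrite ltW// stage_disc_gt0.
  rewrite (le_trans (lerD (ler_normD _ _) h1))//.
  by move: h2 h3 h4; rewrite -/k /stage_cost; lra.
- move=> i; rewrite /update; case: eqP => [-> _|_]; last exact: massV.
  apply: le_trans Vm; apply: ler_sum => j _; exact: small_partS_sqr_le.
apply: le_trans pot.
rewrite /walk_potential /potential lerD2r; apply: ler_sum => t _.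
rewrite ler_expR /test lerD2r; apply: ler_sum => i _.
rewrite ler_wpM2l ?test_coef_ge0//.
rewrite /stage_energy /update; case: (eqVneq i i0) => [->|_]//.
move: (test_stage t) => k.
case: (ltngtP (p i0).+1 k) => [pk|pk|pk].
- exact: lexx.
- by case: ifP => // _; exact: row_energy_ge0.
- rewrite -pk /row_energy subrr mulr0 expr0n addr0 sqrtr1 subrr add0r.
  rewrite /initial_energy ler_wpM2l //=.
    by apply: mulr_ge0; last exact: sqr_ge0.
  apply: le_trans Vm; rewrite /alive_mass [leRHS]big_mkcond; apply: ler_sum => j _.
  case: ifPn => [_|/frozen xj].
    apply: le_trans (small_partS_sqr_le _ _ _).
    by rewrite ler_piMr ?sqr_ge0// gerBl sqr_ge0.
  by rewrite -[x 0 j ^+ 2]real_normK ?num_real// xj expr1n subrr mulr0.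
Qed.

Lemma walk_state_freeze V p o x j : walk_state V p o x ->
  `|x 0 j| = 1 -> walk_state (V :\ j) p o x.
Proof.
move=> [cube frozen stage disc past massV pot] xj.
have sub k : k \notin V -> k \notin V :\ j by rewrite !inE => /negbTE ->; rewrite andbF.
split => //.
- move=> k; rewrite !inE negb_and negbK => /orP[/eqP ->//|]; exact: frozen.
- by move=> i y y1 yx; apply: past => // k /sub; exact: yx.
move=> i pi0; apply: le_trans (massV i pi0).
rewrite /alive_mass [leRHS]big_mkcond [leLHS]big_mkcond; apply: ler_sum => k _.
by rewrite !inE; case: (k \in V); rewrite ?andbF//; case: ifP => // _; exact: sqr_ge0.
Qed.

(** The feasible set is compact and contains [x]. The minimiser inherits [ws_past] because that
    bound holds for all values of the alive entries. *)
Lemma walk_state_minimize V p o x : walk_state V p o x ->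
  exists2 y, walk_state V p o y &
    forall z, feasible V p o y z -> walk_potential p o y <= walk_potential p o z.
Proof.
move=> ws; have [cube frozen stage disc past massV pot] := ws.
pose K := [set y : 'rV[R]_n | feasible V p o x y]%classic.
have K0 : (K !=set0)%classic by exists x; split.
have fc (h : 'rV[R]_n -> R) (c : R) : continuous h ->
    closed [set y : 'rV[R]_n | `|h y| <= c]%classic.
  move=> hc; apply: (@closed_comp _ _ (fun y => `|h y|) [set r : R | r <= c]%classic).
    by move=> y _; apply: continuous_compf => //; exact: norm_continuous.
  exact: closed_le.
have KE : K = ((\bigcap_j [set y : 'rV[R]_n | `|y 0 j| <= 1]) `&`
    ((\bigcap_(j in [set j | j \notin V]) [set y : 'rV[R]_n | `|y 0 j - x 0 j| <= 0])) `&`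
    (\bigcap_i [set y : 'rV[R]_n | `|dot (small_part (p i) i) y - o i| <= radius (p i)]))%classic.
  apply/seteqP; split => y.
    move=> [h1 h2 h3]; split; first split.
    - by move=> j _; exact: h1.
    - by move=> j jV /=; rewrite h2// subrr normr0.
    - by move=> i _; exact: h3.
  move=> [[h1 h2] h3]; split.
  - by move=> j; exact: h1.
  - by move=> j /h2 /=; rewrite normr_le0 subr_eq0 => /eqP.
  - by move=> i; exact: h3.
have cK : compact K.
  apply: bounded_closed_compact.
    exists 1; split => // M M1 y [y1 _ _] /=.
    rewrite /Num.norm/= mx_normrE; apply/bigmax_leP; split => [|[i j] _ /=].
      by rewrite (le_trans ler01)// ltW.
    by rewrite ord1 (le_trans (y1 j))// ltW.
  rewrite KE; apply: closedI; first apply: closedI.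
  - by apply: closed_bigI => j _; apply: fc; exact: coord_continuous_rV.
  - apply: closed_bigI => j _; apply: fc.
    by apply: continuous_subf; [exact: coord_continuous_rV|exact: continuous_constf].
  - apply: closed_bigI => i _; apply: fc.
    by apply: continuous_subf; [exact: dot_continuous|exact: continuous_constf].
have pc : continuous (walk_potential p o) by exact: potential_continuous.
have [y yK ymin] := EVT_min_rV K0 cK (continuous_subspaceT pc).
rewrite inE in yK; have [y1 yx yd] := yK.
exists y; last first.
  move=> z [z1 zy zd]; apply: ymin; rewrite inE; split => // j jV.
  by rewrite zy// yx.
split => //.
- by move=> j jV; rewrite yx// frozen.
- by move=> i z z1 zy; apply: past => // j jV; rewrite zy// yx.
by apply: le_trans pot; apply: ymin; rewrite inE; split.
Qed.

End Walk.

(** * A direction of descent *)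

Section Direction.
Variables (R : realType) (n : nat) (I : finType) (a : I -> 'I_n -> R).
Variables (ell : nat) (lam : R).
Hypothesis n_gt0 : (0 < n)%N.
Hypothesis ell_gt0 : (0 < ell)%N.
Hypothesis lam_ge1 : 1 <= lam.
Hypothesis col_le1 : forall j, \sum_i a i j ^+ 2 <= 1.
Hypothesis test_count : ell%:R * n%:R + #|I|%:R + 1 <= expR (4 * lam ^+ 4).
Hypothesis lam_ell : lam ^+ 4 <= 2 ^+ ell.

Variables (V : {set 'I_n}) (p : I -> nat) (o : I -> R) (x : 'rV[R]_n).
Hypothesis ws : walk_state a ell lam V p o x.
Hypothesis active : forall i, (p i <= ell)%N ->
  mass R (p i) < alive_mass a lam V (p i) i.

Let sp := small_part a lam.
Let tst := test sp (rate ell lam) (initial_energy ell lam) (@test_stage n I ell)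
  (@test_coef _ _ _ a ell lam) (@test_offset R n I ell lam) p o x.
Let d i := dot (sp (p i) i) x - o i.

Let lam_gt0 : 0 < lam. Proof. exact: lt_le_trans lam_ge1. Qed.

(** One exponential is at most the sum of all; the [+ 1] of [test_count] pays for the quadratic term
    of the potential. *)
Lemma test_le t : tst t <= 4 * lam ^+ 4.
Proof.
rewrite -ler_expR; apply: le_trans test_count.
have := ws_potential ws; rewrite /walk_potential /potential -/sp.
have sq : n%:R^-1 * \sum_j x 0 j ^+ 2 <= 1.
  rewrite ler_pdivrMl ?ltr0n// mulr1 -[in leRHS](card_ord n) -sum1_card natr_sum.
  apply: ler_sum => j _.
  by rewrite -real_normK ?num_real// expr_le1// (ws_cube ws).
have : expR (tst t) <= \sum_t expR (tst t).
  by rewrite (bigD1 t)//= lerDl sumr_ge0// => *; exact: expR_ge0.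
by rewrite /tst; lra.
Qed.

Lemma sum_alive_mass_le (S : {set I}) k :
  \sum_(i in S) alive_mass a lam V k i <= #|V|%:R.
Proof.
rewrite /alive_mass exchange_big/= -sum1_card natr_sum; apply: ler_sum => j _.
apply: le_trans (col_le1 j); rewrite [leLHS]big_mkcond; apply: ler_sum => i _.
by case: ifP => _; [exact: small_part_sqr_le|exact: sqr_ge0].
Qed.

(** Double counting of squared mass: a row of the stage holds more than [mass k] by [active], an
    alive column at most 1. *)
Lemma card_stage_le k : (k <= ell)%N ->
  #|[set i | p i == k]|%:R * mass R k <= #|V|%:R.
Proof.
move=> kl; apply: le_trans (sum_alive_mass_le [set i | p i == k] k).
rewrite -sum1_card natr_sum mulr_suml; apply: ler_sum => i.
by rewrite inE mul1r => /eqP pk; rewrite -pk ltW// active// pk.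
Qed.

Lemma ell_ge1 : 1 <= ell%:R :> R.
Proof. by rewrite ler1n. Qed.

(** The left side bounds the energy seen by one column. The entry energy gives [32 lam^2 mass k]; in
    the other term the squared cutoff, of order [1 / lam^2], brings [lam^4] down to [lam^2]. *)
Lemma stage_budget k : (0 < k <= ell)%N ->
  initial_energy ell lam k + 4 * lam ^+ 4 / temperature ell lam k <=
  33 * ell%:R * lam ^+ 2 * mass R k.
Proof.
case: k => // k /andP[_ kl]; rewrite /initial_energy /rate kl /=.
rewrite /temperature invrK /spectral_bound /cutoff.
have mE : mass R k = 2 * mass R k.+1 by rewrite massS; field.
rewrite mE; move: (mass_gt0 R k.+1) => m0; set m := mass R k.+1 in m0 *.
have -> : 4 * lam ^+ 4 * (8 * ell%:R / m * (2 * m / (512 * lam)) ^+ 2) =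
   2048^-1 * (ell%:R * lam ^+ 2 * m).
  by field; rewrite !gt_eqF.
have h : lam ^+ 2 * m <= ell%:R * lam ^+ 2 * m.
  by rewrite -mulrA ler_peMl ?ell_ge1// mulr_ge0 ?sqr_ge0// ltW.
have h0 : 0 <= lam ^+ 2 * m by rewrite mulr_ge0 ?sqr_ge0// ltW.
by rewrite -![33 * _ * _ * _]mulrA -![_ * lam ^+ 2 * _]mulrA in h *; lra.
Qed.

Lemma tight_energy_ge i k : (0 < k <= ell)%N -> p i = k ->
  `|d i| = radius ell lam (p i) ->
  264 * ell%:R ^+ 2 * lam ^+ 2 <=
  stage_energy sp (rate ell lam) (initial_energy ell lam) p o x k i.
Proof.
move=> /andP[k0 kl] pk di.
rewrite /stage_energy pk ltnn eqxx /row_energy.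
apply: (@le_trans _ _
  (Num.sqrt (1 + (rate ell lam k * (dot (sp k i) x - o i)) ^+ 2) - 1)); last first.
  rewrite lerDl; apply: mulr_ge0; first by apply: mulr_ge0; last exact: sqr_ge0.
  apply: sumr_ge0 => j _; rewrite mulr_ge0 ?sqr_ge0// subr_ge0.
  by rewrite -real_normK ?num_real// expr_le1// (ws_cube ws).
have dE : `|rate ell lam k * (dot (sp k i) x - o i)| = 528 * ell%:R ^+ 2 * lam ^+ 2.
  rewrite normrM -pk -/(d i) di /rate pk kl /radius gtn_eqF// /stage_disc.
  by rewrite gtr0_norm//; ring.
rewrite lerBrDr -[(rate _ _ _ * _) ^+ 2]real_normK ?num_real// dE.
have h : 1 <= ell%:R ^+ 2 * lam ^+ 2 :> R.
  by rewrite -exprMn exprn_ege1// mulr_ege1// ell_ge1.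
have -> : 528 * ell%:R ^+ 2 * lam ^+ 2 = 528 * (ell%:R ^+ 2 * lam ^+ 2) :> R by ring.
have -> : 264 * ell%:R ^+ 2 * lam ^+ 2 = 264 * (ell%:R ^+ 2 * lam ^+ 2) :> R by ring.
move: h; set z := ell%:R ^+ 2 * lam ^+ 2 => h.
have z0 : 0 <= 264 * z + 1 by lra.
rewrite -[leLHS](ger0_norm z0) -sqrtr_sqr ler_wsqrtr//; nra.
Qed.

(** The energy weighted by squared entries is summed over the alive columns in two ways: by columns
    it is limited by [stage_budget], by rows each tight one contributes at least [mass k] times
    [tight_energy_ge]. *)
Lemma card_tight_le k : (0 < k <= ell)%N ->
  #|[set i | (p i == k) && (`|d i| == radius ell lam (p i))]|%:R * (8 * ell%:R)
    <= #|V|%:R :> R.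
Proof.
move=> k0l; have [k0 kl] := andP k0l.
set D := [set i | _].
pose Z := stage_energy sp (rate ell lam) (initial_energy ell lam) p o x k.
have Z0 i : 0 <= Z i by apply: stage_energy_ge0 => //; exact: ws_cube ws.
have m0 := mass_gt0 R k.
have l2 : 0 < lam ^+ 2 by rewrite exprn_gt0.
have e0 : 0 < ell%:R :> R by rewrite ltr0n.
have col j : \sum_i sp k i j ^+ 2 * Z i <= 33 * ell%:R * lam ^+ 2 * mass R k.
  apply: le_trans (stage_budget k0l).
  have kE : (k = k.-1.+1)%N by rewrite prednK.
  have k1 : (k.-1 < ell)%N by rewrite -kE.
  have := test_le (inl (Ordinal k1, j)).
  rewrite /tst /test /= -kE.
  under eq_bigr do rewrite -mulrA.
  rewrite -mulr_sumr -/(Z _) -mulrBr -ler_pdivlMl ?temperature_gt0//.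
  by rewrite lerBlDl mulrC.
have lower : #|D|%:R * (mass R k * (264 * ell%:R ^+ 2 * lam ^+ 2)) <=
    \sum_(j in V) \sum_i sp k i j ^+ 2 * Z i.
  rewrite exchange_big/= -sum1_card natr_sum mulr_suml big_mkcond/=.
  apply: ler_sum => i _; rewrite inE -mulr_suml.
  case: ifPn => [/andP[/eqP pk /eqP di]|_]; last first.
    by rewrite mulr_ge0// sumr_ge0// => *; exact: sqr_ge0.
  rewrite mul1r; apply: ler_pM; first exact: ltW.
  - by apply: mulr_ge0; [apply: mulr_ge0; [exact: ler0n|exact: sqr_ge0]|exact: ltW].
  - by have := @active i; rewrite pk => /(_ kl)/ltW.
  - exact: tight_energy_ge.
have upper : \sum_(j in V) \sum_i sp k i j ^+ 2 * Z i <=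
    #|V|%:R * (33 * ell%:R * lam ^+ 2 * mass R k).
  by rewrite -sum1_card natr_sum mulr_suml; apply: ler_sum => j _; rewrite mul1r.
have ub := le_trans lower upper.
have q0 : 0 < 33 * ell%:R * lam ^+ 2 * mass R k.
  by rewrite !mulr_gt0.
rewrite -(ler_pM2r q0); apply: le_trans ub.
by rewrite le_eqVlt; apply/orP; left; apply/eqP; ring.
Qed.

(** The row's own test bounds rate times [|d i|] by [1 + 4 lam^4 + 128 lam^2 2^ell]. As
    [lam^4 <= 2^ell], division by the rate [lam 2^ell] leaves at most [5 + 128 lam]. *)
Lemma final_disc_lt i : p i = ell.+1 -> `|d i| < radius ell lam (p i).
Proof.
move=> pi.
have := test_le (inr i); rewrite /tst /test /=.
rewrite (bigD1 i)//= eqxx mul1r big1 ?addr0; last first.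
  by move=> j /negbTE ->; rewrite mul0r.
rewrite /stage_energy pi ltnn eqxx /row_energy.
set S := 16 * _ * \sum_j _.
have S0 : 0 <= S.
  apply: mulr_ge0; first by apply: mulr_ge0; last exact: sqr_ge0.
  apply: sumr_ge0 => j _; rewrite mulr_ge0 ?sqr_ge0// subr_ge0.
  by rewrite -real_normK ?num_real// expr_le1// (ws_cube ws).
rewrite /initial_energy /rate ltnn /=.
have le := lam_ell; set e2 := 2 ^+ ell in le *.
have e21 : 1 <= e2 by rewrite exprn_ege1// ler1n.
have mE : mass R ell = 8 / e2 by [].
have -> : 16 * (lam * e2) ^+ 2 * mass R ell = 128 * lam * (lam * e2).
  by rewrite mE; field; rewrite gt_eqF// (lt_le_trans ltr01).
have dE : dot (sp ell.+1 i) x - o i = d i by rewrite /d pi.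
rewrite dE.
set q := Num.sqrt _.
have qd : lam * e2 * `|d i| <= q.
  have -> : lam * e2 * `|d i| = `|lam * e2 * d i|.
    by rewrite !normrM (gtr0_norm lam_gt0) (ger0_norm (le_trans ler01 e21)).
  by rewrite -sqrtr_sqr ler_wsqrtr// lerDr.
move=> qle.
have le2 : e2 <= lam * e2 by rewrite ler_peMl// (le_trans ler01 e21).
have m0 : 0 < lam * e2 by rewrite mulr_gt0// (lt_le_trans ltr01).
have : lam * e2 * `|d i| <= lam * e2 * (5 + 128 * lam).
  by lra.
rewrite ler_pM2l// => dle.
rewrite /radius /= /stage_disc (le_lt_trans dle)//.
have h : 1 <= ell%:R ^+ 2 :> R by rewrite exprn_ege1// ell_ge1.
have : lam <= ell%:R ^+ 2 * lam by rewrite ler_peMl// ltW.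
rewrite -[X in _ -> _ < X]mulrA; move: (ell%:R ^+ 2 * lam) lam_ge1 => z.
lra.
Qed.

(** Stage 0 has at most [#|V| / 8] rows, each of the [ell] middle stages at most [#|V| / (8 ell)]
    tight ones, and the last stage none. *)
Lemma card_tight : #|[set i | `|d i| == radius ell lam (p i)]|%:R * 4 <= #|V|%:R :> R.
Proof.
have pl i : `|d i| == radius ell lam (p i) -> (p i < ell.+1)%N.
  move=> di; have := ws_stage ws i; rewrite leq_eqVlt => /orP[/eqP|//].
  by move=> /final_disc_lt; rewrite (eqP di) ltxx.
have -> : #|[set i | `|d i| == radius ell lam (p i)]| =
   (\sum_(k < ell.+1) #|[set i | (p i == k) && (`|d i|%R == radius ell lam (p i))]|)%N.
  rewrite -sum1_card (partition_big (fun i => inord (p i) : 'I_ell.+1) predT)//=.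
  apply: eq_bigr => k _; rewrite -sum1_card; apply: eq_bigl => i.
  rewrite !inE andbC; case: (boolP (_ == radius _ _ _)); rewrite ?andbF// !andbT => di.
  by rewrite -val_eqE /= inordK// pl.
rewrite natr_sum big_ord_recl mulrDl mulr_suml.
have e0 : 0 < ell%:R :> R by rewrite ltr0n.
have h0 : #|[set i | (p i == 0%N) && (`|d i| == radius ell lam (p i))]|%:R * 8 <= #|V|%:R :> R.
  apply: le_trans (card_stage_le (leq0n _)).
  rewrite (_ : mass R 0 = 8); last by rewrite /mass expr0 divr1.
  rewrite ler_wpM2r// ler_nat subset_leq_card//.
  by apply/fintype.subsetP => i; rewrite !inE => /andP[].
have h1 : \sum_(k < ell)
    #|[set i | (p i == lift ord0 k) && (`|d i| == radius ell lam (p i))]|%:R * 4 <= \sum_(k < ell) (#|V|%:R / (2 * ell%:R)) :> R.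
  apply: ler_sum => k _; rewrite ler_pdivlMr ?mulr_gt0//.
  apply: le_trans (card_tight_le (k := lift ord0 k) _); last by rewrite /= ltn_ord.
  by rewrite le_eqVlt; apply/orP; left; apply/eqP; ring.
have h2 : \sum_(k < ell) (#|V|%:R / (2 * ell%:R)) = #|V|%:R / 2 :> R.
  by rewrite sumr_const card_ord -mulr_natl; field; rewrite gt_eqF.
by move: h0 h1; rewrite h2; lra.
Qed.

Let T := tests n I ell.
Let f (t : T) := expR (tst t).
Let cf := @test_coef _ _ _ a ell lam.
Let st := @test_stage n I ell.
Let mu := rate ell lam.
Let g i v := slope sp mu (p i) i (o i) x v.
Let omega i := \sum_(t : T | p i == st t) f t * cf t i.

Let gvec i j : R :=
  let y := mu (p i) * (dot (sp (p i) i) x - o i) in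
  mu (p i) * (y / Num.sqrt (1 + y ^+ 2)) * sp (p i) i j
  - 32 * mu (p i) ^+ 2 * (sp (p i) i j ^+ 2 * x 0 j).

Let gE i v : g i v = \sum_j gvec i j * v 0 j.
Proof.
rewrite /g /slope /gvec /dot /sqdot !mulr_sumr -sumrB.
by apply: eq_bigr => j _; ring.
Qed.

(** The variables of the form are the slopes [g i v] of the rows in the stage, with one summand per
    column. Since the slopes are linear in [v], the excluded directions pull back to linear
    conditions on [v]. *)
Lemma stage_forms (k : 'I_ell) : exists S : seq {ffun 'I_n -> R},
  (size S)%:R * (8 * ell%:R) <= #|V|%:R :> R /\
  forall v : 'rV[R]_n, (forall e, e \in S -> \sum_j e j * v 0 j = 0) ->
  \sum_j f (inl (k, j)) * (\sum_(i | p i == k.+1) cf (inl (k, j)) i * g i v) ^+ 2 <=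
  \sum_j f (inl (k, j)) * \sum_(i | p i == k.+1) cf (inl (k, j)) i * g i v ^+ 2.
Proof.
pose A := [set i | p i == k.+1].
have inA i : (i \in A) = (p i == k.+1) by rewrite inE.
have Cp := spectral_bound_gt0 R ell_gt0 k.+1.
have [S [Ssize HS]] := quadratic_form_le_diag_off_few A (fun j i => cf (inl (k, j)) i)
  Cp (fun j => expR_ge0 (tst (inl (k, j)))).
exists [seq [ffun j => \sum_(i in A) e i * gvec i j] | e : {ffun I -> R} <- S]; split.
  have h := card_stage_le (ltn_ord k).
  have m0 := mass_gt0 R k.+1.
  apply: le_trans h; rewrite -ler_pdivrMr//; apply: le_trans Ssize.
  by rewrite size_map -mulrA.
move=> v Sv; have {}HS := HS (fun i => g i v).
have E (h : I -> R) : \sum_(i in A) h i = \sum_(i | p i == k.+1) h i.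
  by apply: eq_bigl => i; rewrite inA.
under eq_bigr do rewrite -E.
apply: le_trans (HS _) _.
  move=> e eS; rewrite -[RHS](Sv [ffun j => \sum_(i in A) e i * gvec i j]); last first.
    by apply/mapP; exists e.
  under [RHS]eq_bigr do rewrite ffunE mulr_suml.
  rewrite exchange_big/=; apply: eq_bigr => i _.
  by rewrite gE mulr_sumr; apply: eq_bigr => j _; rewrite mulrA.
under [leRHS]eq_bigr do rewrite mulr_sumr.
rewrite exchange_big/= mulr_sumr E; apply: ler_sum => i pi.
rewrite mulrA mulr_sumr mulr_suml; apply: ler_sum => j _.
rewrite [leRHS]mulrA ler_wpM2r ?sqr_ge0// mulrCA ler_wpM2l ?expR_ge0//.
have c0 := cutoff_gt0 lam_ge1 k.+1.
have -> : spectral_bound R ell k.+1 * cf (inl (k, j)) i ^+ 2 =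
  cf (inl (k, j)) i * (small_part a lam k.+1 i j ^+ 2 / cutoff lam k.+1 ^+ 2).
  rewrite /cf /test_coef /temperature; field.
  by rewrite !gt_eqF.
rewrite ler_piMr//; first exact: test_coef_ge0.
rewrite ler_pdivrMr ?exprn_gt0// mul1r -[leLHS]real_normK ?num_real//.
by rewrite ler_sqr ?nnegrE ?(ltW c0)// small_part_le.
Qed.

(** Here the variables are the alive coordinates of [v], with two linear forms per row and [C = 4].
    Small entries make the diagonal at most a quarter of the right side. *)
Lemma coordinate_forms : exists S : seq {ffun 'I_n -> R},
  (size S)%:R * 4 <= #|V|%:R :> R /\
  forall v : 'rV[R]_n, (forall j, j \notin V -> v 0 j = 0) ->
  (forall e, e \in S -> \sum_j e j * v 0 j = 0) ->
  \sum_i omega i * (5 / 2 * mu (p i) ^+ 2 * dot (sp (p i) i) v ^+ 2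
    + 2048 * mu (p i) ^+ 4 * sqdot (sp (p i) i) x v ^+ 2) <=
  \sum_i omega i * (16 * mu (p i) ^+ 2 * \sum_j sp (p i) i j ^+ 2 * v 0 j ^+ 2).
Proof.
have cf0 t i : 0 <= cf t i by exact: test_coef_ge0.
have omega0 i : 0 <= omega i by apply: sumr_ge0 => t _; rewrite mulr_ge0// expR_ge0.
pose h (t : I + I) := match t with
  | inl i => omega i * (5 / 2 * mu (p i) ^+ 2)
  | inr i => omega i * (2048 * mu (p i) ^+ 4) end.
pose w (t : I + I) j := match t with
  | inl i => sp (p i) i j | inr i => sp (p i) i j ^+ 2 * x 0 j end.
have h0 t : 0 <= h t.
  case: t => i; (apply: mulr_ge0; first exact: omega0).
    by apply: mulr_ge0; [apply: divr_ge0; exact: ler0n|exact: sqr_ge0].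
  by apply: mulr_ge0; [exact: ler0n|exact: exprn_even_ge0].
have C4 : 0 < 4 :> R by [].
have [S [Ssize HS]] := quadratic_form_le_diag_off_few V w C4 h0.
exists S; split => // v vV Sv.
have EV (u : 'I_n -> R) : \sum_(j in V) u j * v 0 j = \sum_j u j * v 0 j.
  by rewrite big_mkcond; apply: eq_bigr => j _; case: ifPn => // /vV ->; rewrite mulr0.
have EV2 (u : 'I_n -> R) : \sum_(j in V) u j * v 0 j ^+ 2 = \sum_j u j * v 0 j ^+ 2.
  rewrite big_mkcond; apply: eq_bigr => j _.
  by case: ifPn => // /vV ->; rewrite expr0n mulr0.
have := HS (fun j => v 0 j) _.
rewrite big_sumType/=.
under eq_bigr do rewrite EV.
under [X in _ + X]eq_bigr do rewrite EV.
move=> H.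
have {}H := H (fun e eS => etrans (EV e) (Sv e eS)).
have -> : \sum_i omega i * (5 / 2 * mu (p i) ^+ 2 * dot (sp (p i) i) v ^+ 2
    + 2048 * mu (p i) ^+ 4 * sqdot (sp (p i) i) x v ^+ 2) =
  \sum_i omega i * (5 / 2 * mu (p i) ^+ 2) * (\sum_j sp (p i) i j * v 0 j) ^+ 2 +
  \sum_i omega i * (2048 * mu (p i) ^+ 4) *
    (\sum_j sp (p i) i j ^+ 2 * x 0 j * v 0 j) ^+ 2.
  rewrite -big_split/=; apply: eq_bigr => i _.
  have -> : sqdot (sp (p i) i) x v = \sum_j sp (p i) i j ^+ 2 * x 0 j * v 0 j.
    by apply: eq_bigr => j _; rewrite mulrA.
  by rewrite mulrDr !mulrA.
apply: le_trans H _.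
rewrite EV2.
have -> : \sum_i omega i * (16 * mu (p i) ^+ 2 * \sum_j sp (p i) i j ^+ 2 * v 0 j ^+ 2) =
  4 * \sum_j (\sum_i omega i * (4 * mu (p i) ^+ 2 * sp (p i) i j ^+ 2)) * v 0 j ^+ 2.
  rewrite mulr_sumr.
  under [RHS]eq_bigr do rewrite mulr_suml mulr_sumr.
  rewrite exchange_big/=; apply: eq_bigr => i _.
  by rewrite !mulr_sumr; apply: eq_bigr => j _; ring.
rewrite ler_wpM2l//; apply: ler_sum => j _.
rewrite ler_wpM2r ?sqr_ge0// big_sumType/= -big_split/=.
apply: ler_sum => i _.
rewrite -!mulrA -mulrDr.
(* No test has stage 0, so such rows have weight 0; for positive stages rate times cutoff is at most
   1/64. *)
have [p0|p0] := posnP (p i).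
  have -> : omega i = 0.
    rewrite /omega big1// => t; rewrite p0; by case: t.
  by rewrite !mul0r.
rewrite ler_wpM2l//.
have pS : p i = (p i).-1.+1 by rewrite prednK.
have mc : mu (p i) * `|sp (p i) i j| <= 64^-1.
  apply: le_trans (_ : mu (p i) * cutoff lam (p i) <= _).
    by rewrite ler_wpM2l ?small_part_le// ltW// rate_gt0.
  rewrite pS rate_cutoff//.
  by have := ws_stage ws i; rewrite {1}pS ltnS.
have mc2 : mu (p i) ^+ 2 * sp (p i) i j ^+ 2 <= 4096^-1.
  have m0 : 0 <= mu (p i) by rewrite ltW// rate_gt0.
  have : (mu (p i) * `|sp (p i) i j|) ^+ 2 <= 64^-1 ^+ 2.
    by rewrite ler_sqr ?nnegrE ?mulr_ge0// invr_ge0.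
  rewrite exprMn real_normK ?num_real// => /le_trans; apply.
  by rewrite le_eqVlt; apply/orP; left; apply/eqP; field.
have x2 : x 0 j ^+ 2 <= 1.
  by rewrite -real_normK ?num_real// expr_le1// (ws_cube ws).
set u := sp (p i) i j in mc2 *; set m := mu (p i) in mc2 *.
have b1 : m ^+ 2 * u ^+ 2 * x 0 j ^+ 2 <= 4096^-1.
  apply: le_trans mc2; rewrite ler_piMr// mulr_ge0 ?sqr_ge0//.
have mu0 : 0 <= m ^+ 2 * u ^+ 2 by rewrite mulr_ge0 ?sqr_ge0.
have b2 := ler_wpM2l mu0 b1.
(* As [m^2 u^2 <= 1/4096], the coefficient is at most [5/2 + 2048/4096 = 3], below [4 = 16 / C]. *)
apply: le_trans (_ : 5 / 2 * (m ^+ 2 * u ^+ 2) +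
  2048 * (m ^+ 2 * u ^+ 2 * (m ^+ 2 * u ^+ 2 * x 0 j ^+ 2)) <= _).
  by rewrite le_eqVlt; apply/orP; left; apply/eqP; ring.
have -> : m * (m * u ^+ 2) = m ^+ 2 * u ^+ 2 by ring.
by move: b2 mu0; set z := m ^+ 2 * u ^+ 2; lra.
Qed.

(** Tight rows exclude at most [#|V| / 4] directions, the stage forms [#|V| / 8] altogether, and the
    coordinate forms [#|V| / 4], which leaves room for a nonzero [v]. *)
Lemma direction_exists : V != finset.set0 -> exists v : 'rV[R]_n,
  [/\ exists j, v 0 j != 0, forall j, j \notin V -> v 0 j = 0,
     forall i, `|d i| = radius ell lam (p i) -> dot (sp (p i) i) v = 0,
     \sum_t f t * (\sum_(i | p i == st t) cf t i * g i v) ^+ 2 <=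
     \sum_t f t * \sum_(i | p i == st t) cf t i * g i v ^+ 2 &
     \sum_i omega i * (5 / 2 * mu (p i) ^+ 2 * dot (sp (p i) i) v ^+ 2
       + 2048 * mu (p i) ^+ 4 * sqdot (sp (p i) i) x v ^+ 2) <=
     \sum_i omega i * (16 * mu (p i) ^+ 2 * \sum_j sp (p i) i j ^+ 2 * v 0 j ^+ 2)].
Proof.
move=> V0.
pose B := [set i | `|d i| == radius ell lam (p i)].
pose SB := [seq [ffun j => sp (p i) i j] | i <- enum B].
pose Sk k := projT1 (cid (stage_forms k)).
have [Sc [Sc_size Sc_le]] := coordinate_forms.
pose Ss := flatten [seq Sk k | k <- enum 'I_ell].
have e0 : 0 < ell%:R :> R by rewrite ltr0n.
have SB_size : (size SB)%:R * 4 <= #|V|%:R :> R.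
  by rewrite size_map -cardE; exact: card_tight.
have Ss_size : (size Ss)%:R * 8 <= #|V|%:R :> R.
  rewrite size_flatten sumnE /shape !big_map natr_sum mulr_suml -enumT big_enum/=.
  apply: (@le_trans _ _ (\sum_(k < ell) #|V|%:R / ell%:R)).
    apply: ler_sum => k _; rewrite ler_pdivlMr// -mulrA.
    by rewrite /Sk; case: cid => S [].
  by rewrite sumr_const card_ord -[_ *+ ell]mulr_natr divfK ?gt_eqF.
have S_size : (size (SB ++ Ss ++ Sc) < #|V|)%N.
  rewrite -(ltr_nat R) !size_cat !natrD.
  have : 0 < #|V|%:R :> R by rewrite ltr0n card_gt0.
  by move: Sc_size SB_size Ss_size; lra.
have [u [u0 uV uS]] := exists_kernel_vector S_size.
pose v : 'rV[R]_n := \row_j u j.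
have vS e : e \in SB ++ Ss ++ Sc -> \sum_j e j * v 0 j = 0.
  by move=> eS; under eq_bigr do rewrite mxE; exact: uS.
have vV j : j \notin V -> v 0 j = 0 by move=> /uV; rewrite mxE.
exists v; split => //.
- by have [j uj] := u0; exists j; rewrite mxE.
- move=> i di; rewrite -[RHS](vS [ffun j => sp (p i) i j]); last first.
    rewrite mem_cat; apply/orP; left; apply/mapP; exists i => //.
    by rewrite mem_enum inE di.
  by apply: eq_bigr => j _; rewrite ffunE.
- rewrite !big_sumType/=; apply: lerD.
    have E (h : 'I_ell * 'I_n -> R) : \sum_kj h kj = \sum_k \sum_j h (k, j).
      by rewrite pair_bigA; apply: eq_bigr => -[].
    rewrite !E/=.
    apply: ler_sum => k _.
    have := projT2 (cid (stage_forms k)) => /= -[_]; apply => e eS.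
    apply: vS; rewrite !mem_cat; apply/orP; right; apply/orP; left.
    by apply/flatten_mapP; exists k => //; rewrite mem_enum.
  (* A test [inr i] involves a single row, for which decoupling is an equality. *)
  apply: ler_sum => i _; rewrite ler_wpM2l ?expR_ge0//.
  have E (h : I -> R) : \sum_(i' | p i' == ell.+1) (i' == i)%:R * h i' =
      if p i == ell.+1 then h i else 0.
    rewrite big_mkcond (bigD1 i)//= eqxx mul1r big1 ?addr0// => i' /negbTE ->.
    by rewrite mul0r if_same.
  by rewrite !E; case: ifP => // _; rewrite expr0n.
- apply: Sc_le => // e eS; apply: vS.
  by rewrite !mem_cat eS !orbT.
Qed.

(* The average of the potential over [x + s v] and [x - s v] is below its value
   at [x]. *)
Lemma minimizer_not_interior : V != finset.set0 ->
  (forall j, j \in V -> `|x 0 j| < 1) ->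
  (forall z, feasible a ell lam V p o x z ->
     walk_potential a ell lam p o x <= walk_potential a ell lam p o z) -> False.
Proof.
move=> V0 x1 xmin.
have [v [v0 vV vd dec spr]] := direction_exists V0.
have eta0 : 0 < n%:R^-1 :> R by rewrite invr_gt0 ltr0n.
have [s1 s10 H1] := potential_descent
  (test_coef_ge0 a ell_gt0 lam_ge1) eta0 v0 dec spr.
have [s2 s20 H2] : exists2 s0, 0 < s0 & forall s, 0 < s <= s0 -> forall j,
    `|x 0 j + s * v 0 j| <= 1 /\ `|x 0 j + (- s) * v 0 j| <= 1.
  apply: exists_uniform_step => j; have [jV|/[dup] jV /vV ->] := boolP (j \in V).
    exact: norm_perturb (x1 j jV).
  by exists 1 => // s _; rewrite !mulr0 addr0; split; rewrite (ws_cube ws).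
have [s3 s30 H3] : exists2 s0, 0 < s0 & forall s, 0 < s <= s0 -> forall i,
    `|d i + s * dot (sp (p i) i) v| <= radius ell lam (p i) /\
    `|d i + (- s) * dot (sp (p i) i) v| <= radius ell lam (p i).
  apply: exists_uniform_step => i; have := ws_disc ws i; rewrite -/sp -/(d i).
  rewrite le_eqVlt => /orP[/eqP di|di].
    by exists 1 => // s _; rewrite (vd _ di) !mulr0 addr0 di.
  exact: norm_perturb di.
pose s := Order.min s1 (Order.min s2 s3).
have s0 : 0 < s by rewrite !lt_min s10 s20 s30.
have ss1 : 0 < s <= s1 by rewrite s0 ge_min lexx.
have ss2 : 0 < s <= s2 by rewrite s0 !ge_min lexx orbT.
have ss3 : 0 < s <= s3 by rewrite s0 !ge_min lexx !orbT.
have feas e : (e = s \/ e = - s) -> feasible a ell lam V p o x (x + e *: v).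
  move=> es; split.
  - by move=> j; rewrite !mxE; have [? ?] := H2 _ ss2 j; case: es => ->.
  - by move=> j /vV vj; rewrite !mxE vj mulr0 addr0.
  - move=> i; rewrite dotDZ addrAC -/sp -/(d i).
    by have [? ?] := H3 _ ss3 i; case: es => ->.
have m1 := xmin _ (feas s (or_introl erefl)).
have m2 := xmin _ (feas (- s) (or_intror erefl)).
have := H1 s ss1; rewrite ltNge => /negP; apply.
by rewrite mulr2n mulrDl mul1r lerD.
Qed.

End Direction.

(** * Running the walk until every coordinate is frozen *)

Section Rounding.
Variables (R : realType) (n : nat) (I : finType) (a : I -> 'I_n -> R).
Variables (ell : nat) (lam : R).
Hypothesis n_gt0 : (0 < n)%N.
Hypothesis ell_gt0 : (0 < ell)%N.
Hypothesis lam_ge1 : 1 <= lam.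
Hypothesis col_le1 : forall j, \sum_i a i j ^+ 2 <= 1.
Hypothesis test_count : ell%:R * n%:R + #|I|%:R + 1 <= expR (4 * lam ^+ 4).
Hypothesis lam_ell : lam ^+ 4 <= 2 ^+ ell.

(** Induction on alive coordinates plus stages left. If no row can advance, [minimizer_not_interior]
    gives a minimiser an alive coordinate equal to 1 or -1, which is frozen. *)
Lemma walk_state_final V p o x : walk_state a ell lam V p o x ->
  exists p' o' x', walk_state a ell lam finset.set0 p' o' x'.
Proof.
pose rank (V : {set 'I_n}) (p : I -> nat) := (#|V| + \sum_i (ell.+1 - p i))%N.
have [N] := ubnP (rank V p).
elim: N => // N IH in V p o x *; rewrite ltnS => VN ws.
have [V0|V0] := eqVneq V finset.set0; first by exists p, o, x; rewrite -V0.
have [/existsP[i /andP[pi Vi]]|/existsPn noadv] := boolP [exists i,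
    (p i <= ell)%N && (alive_mass a lam V (p i) i <= mass R (p i))].
  apply: IH (walk_state_advance ell_gt0 lam_ge1 ws pi Vi).
  apply: leq_trans VN; rewrite /rank ltn_add2l [ltnRHS](bigD1 i)//= [ltnLHS](bigD1 i)//=.
  rewrite /update eqxx -addSn leq_add//; first by rewrite subSS -subSn.
  by apply: leq_sum => i' /negbTE; rewrite /update => ->.
have active i : (p i <= ell)%N -> mass R (p i) < alive_mass a lam V (p i) i.
  by move=> pi; have := noadv i; rewrite pi /= -ltNge.
have [y wsy ymin] := walk_state_minimize ws.
have [/existsP[j /andP[jV /eqP yj]]|/existsPn int] :=
    boolP [exists j, (j \in V) && (`|y 0 j| == 1)].
  apply: IH (walk_state_freeze wsy yj).
  by apply: leq_trans VN; rewrite /rank ltn_add2r [ltnRHS](cardsD1 j) jV.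
exfalso; apply: (minimizer_not_interior n_gt0 ell_gt0 lam_ge1 col_le1 test_count
  lam_ell wsy active V0) => [j jV|]; last exact: ymin.
by rewrite lt_neqAle (ws_cube wsy) andbT; have := int j; rewrite jV.
Qed.

Lemma exists_signing : exists x : 'I_n -> R, (forall j, x j = 1 \/ x j = -1) /\
  forall i, `|\sum_j a i j * x j| <= (ell%:R + 2) * (528 * ell%:R ^+ 2 * lam + 1024 * lam).
Proof.
have ws0 := walk_state_initial ell_gt0 lam_ge1 col_le1.
have [p [z [x ws]]] := walk_state_final ws0.
exists (fun j => x 0 j); split.
  move=> j; have /eqP := ws_frozen ws (j := j) (negbT (finset.in_set0 j)).
  by rewrite eqr_norml => /andP[/orP[] /eqP -> _]; [left|right].
move=> i; rewrite -[\sum_j _]/(dot (a i) x).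
have h1 := ws_past ws i (ws_cube ws) (fun _ _ => erefl).
have h2 := ws_disc ws i.
have -> : dot (a i) x = (dot (a i) x - dot (small_part a lam (p i) i) x + z i)
   + (dot (small_part a lam (p i) i) x - z i) by ring.
rewrite (le_trans (ler_normD _ _))//.
rewrite -/(stage_disc ell lam) -/(stage_cost ell lam).
have c0 : 0 <= stage_cost ell lam.
  apply: addr_ge0; first by rewrite ltW// stage_disc_gt0.
  by apply: mulr_ge0; [exact: ler0n|exact: le_trans lam_ge1].
have h3 : radius ell lam (p i) <= stage_cost ell lam.
  rewrite /radius; case: ifP => // _; rewrite /stage_cost lerDl.
  by apply: mulr_ge0; [exact: ler0n|exact: le_trans lam_ge1].
have h4 : (p i)%:R * stage_cost ell lam <= (ell%:R + 1) * stage_cost ell lam.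
  by rewrite ler_wpM2r// natr1 ler_nat (ws_stage ws).
have -> : (ell%:R + 2) * stage_cost ell lam =
  (ell%:R + 1) * stage_cost ell lam + stage_cost ell lam by ring.
by apply: lerD; [exact: le_trans h4|exact: le_trans h3].
Qed.

End Rounding.


(** * Numerical estimates *)

Section Numerics.
Variable R : realType.

Lemma expR1_lt3 : expR 1 < 3 :> R.
Proof.
have -> : expR 1 = expR (4^-1) ^+ 4 :> R by rewrite -expRM_natl divff.
have := @expR_le_quadratic R 4^-1 _; rewrite ger0_norm ?invr_ge0//.
have h : 4^-1 <= 3^-1 :> R by lra.
move=> /(_ h) e1.
have q0 := expR_ge0 (4^-1 : R); move: (expR 4^-1) q0 e1 => q q0 q1.
have q2 : q * q <= 173 / 100 by nra.
have qq0 : 0 <= q * q by rewrite mulr_ge0.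
rewrite (_ : q ^+ 4 = (q * q) * (q * q)); last by ring.
by nra.
Qed.

Lemma le_expR_half_pow (k : nat) : expR (k%:R / 2) <= 2 ^+ k :> R.
Proof.
rewrite expRM_natl lerXn2r ?nnegrE ?expR_ge0//.
rewrite -ler_sqr ?nnegrE ?expR_ge0// -expRM_natl mulfV//.
by move: expR1_lt3; lra.
Qed.

(** Handles the rows of squared norm at most [1 / n]: any signing gives them discrepancy at most
    1. *)
Lemma sum_norm_le1 (n : nat) (u : 'I_n -> R) : (0 < n)%N ->
  \sum_j u j ^+ 2 <= n%:R^-1 -> \sum_j `|u j| <= 1.
Proof.
move=> n0 un; have n0' : 0 < n%:R :> R by rewrite ltr0n.
apply: (@le_trans _ _ (\sum_j (n%:R * u j ^+ 2 + n%:R^-1) / 2)).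
  (* AM-GM *)
  apply: ler_sum => j _; rewrite ler_pdivlMr// -[u j ^+ 2]real_normK ?num_real//.
  rewrite -subr_ge0 (_ : _ - _ = n%:R * (`|u j| - n%:R^-1) ^+ 2); last first.
    by field; rewrite gt_eqF.
  by rewrite mulr_ge0 ?sqr_ge0// ltW.
rewrite -mulr_suml big_split/= -mulr_sumr sumr_const card_ord -[_^-1 *+ n]mulr_natl mulfV ?gt_eqF//.
have : n%:R * \sum_j u j ^+ 2 <= 1 by rewrite -ler_pdivlMl// mulr1.
by lra.
Qed.

(** For [e >= 1] every monomial is at most [e^3 l], and the coefficients add up to
    [3 * (528 + 1024)]. *)
Lemma rounding_cost_le (e l K z : R) : 1 <= e -> 0 <= l -> e <= K * z ->
  (e + 2) * (528 * e ^+ 2 * l + 1024 * l) <= 3 * (528 + 1024) * K ^+ 3 * l * z ^+ 3.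
Proof.
move=> e1 l0 eKz.
have e0 : 0 <= e by lra.
have h : e ^+ 3 <= K ^+ 3 * z ^+ 3.
  by rewrite -exprMn lerXn2r ?nnegrE ?(le_trans e0 eKz).
have h2 := ler_wpM2r l0 h; set y := K ^+ 3 in h2 *; set w := z ^+ 3 in h2 *.
have -> : 3 * (528 + 1024) * y * l * w = 3 * (528 + 1024) * (y * w * l) by ring.
apply: (@le_trans _ _ (3 * (528 + 1024) * (e ^+ 3 * l))); last by lra.
have -> : (e + 2) * (528 * e ^+ 2 * l + 1024 * l) =
  528 * (e ^+ 3 * l) + 2 * 528 * (e ^+ 2 * l) + 1024 * (e * l) + 2 * 1024 * l by ring.
have l1 : l <= e * l by rewrite ler_peMl.
have l2 : e * l <= e ^+ 2 * l by rewrite expr2 -mulrA ler_peMl// mulr_ge0.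
have l3 : e ^+ 2 * l <= e ^+ 3 * l.
  by rewrite [e ^+ 3]exprS -[leRHS]mulrA ler_peMl// mulr_ge0// sqr_ge0.
by lra.
Qed.

Lemma rounding_cost_ge1 (e l : R) : 1 <= e -> 1 <= l ->
  1 <= (e + 2) * (528 * e ^+ 2 * l + 1024 * l).
Proof.
move=> e1 l1; have h : 0 <= e ^+ 2 * l by rewrite mulr_ge0 ?sqr_ge0//; lra.
by apply: mulr_ege1; lra.
Qed.

End Numerics.

(** * Choice of parameters and conclusion *)

Unset Implicit Arguments.

Theorem theorem1p2 (R : realType) :
  exists (C : R) (k : nat), forall (m n : nat) (A : 'M[R]_(m, n)),
    (3 <= n)%N ->
    (forall j : 'I_n, l2norm (col j A) <= 1) ->
    disc A <= C * ln (n%:R) `^ (1 / 4) * ln (ln (n%:R)) ^+ k.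
Proof.
pose delta : R := ln (ln 3).
have ln3 : 1 < ln 3 :> R.
  by rewrite -ltr_expR lnK ?posrE ?ltr0n// expR1_lt3.
have delta0 : 0 < delta by exact: ln_gt0.
(* As [ln (ln n) >= delta] for [n >= 3], the factor [K] absorbs the rounding up of [ell]. *)
pose K := 2 + delta^-1.
exists (3 * (528 + 1024) * K ^+ 3), 3%N => m n A n3 colA.
have n0 : (0 < n)%N by exact: leq_trans n3.
have nR3 : 3 <= n%:R :> R by rewrite ler_nat.
set L := ln n%:R; set Lam := ln L.
have L3 : ln 3 <= L by rewrite ler_ln ?posrE ?ltr0n.
have L1 : 1 < L by exact: lt_le_trans L3.
have L0 : 0 < L by lra.
have Lamd : delta <= Lam by rewrite ler_ln ?posrE; lra.
have Lam0 : 0 < Lam by exact: lt_le_trans Lamd.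
set lam := L `^ (1 / 4).
have lam4 : lam ^+ 4 = L.
  rewrite -powR_mulrn ?powR_ge0// -powRrM (_ : 1 / 4 * 4%:R = 1); last by field.
  by rewrite powRr1// ltW.
have lam0 : 0 <= lam by exact: powR_ge0.
have lam1 : 1 <= lam.
  rewrite leNgt; apply/negP => lam1.
  have : lam ^+ 4 < 1 by rewrite exprn_ilt1.
  by rewrite lam4; lra.
(* With [ell >= 2 ln (ln n)] one gets [lam^4 = exp (ln (ln n)) <= exp (ell / 2) <= 2^ell]. *)
pose ell := (Num.truncn (2 * Lam)).+1.
have ell0 : (0 < ell)%N by [].
have ell1 : 1 <= ell%:R :> R by rewrite ler1n.
have ell_gt : 2 * Lam <= ell%:R by rewrite ltW// truncnS_gt.
have ell_le : ell%:R <= 2 * Lam + 1.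
  by rewrite /ell -(natr1 (Num.truncn _)) lerD2r truncn_le// mulr_ge0// ltW.
have ell_K : ell%:R <= K * Lam.
  apply: le_trans ell_le _.
  have -> : K * Lam = 2 * Lam + delta^-1 * Lam by rewrite /K; ring.
  by rewrite lerD2l ler_pdivlMl// mulr1.
move: ell ell0 ell1 ell_gt ell_K ell_le => ell ell0 ell1 ell_gt ell_K ell_le.
have col1 j : \sum_i A i j ^+ 2 <= 1.
  have := colA j; rewrite /l2norm => h.
  have S0 : 0 <= \sum_i (col j A) i 0 ^+ 2 by apply: sumr_ge0 => *; exact: sqr_ge0.
  rewrite (_ : \sum_i _ = \sum_i (col j A) i 0 ^+ 2); last first.
    by apply: eq_bigr => i _; rewrite !mxE.
  by rewrite -[leLHS]sqr_sqrtr// expr_le1// sqrtr_ge0.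
(* The total squared mass is at most [n], so at most [n^2] rows are this heavy; the number of tests
   is then polynomial in [n], whatever [m] is. *)
pose P := [set i : 'I_m | n%:R^-1 < \sum_j A i j ^+ 2].
pose a (k : 'I_#|P|) j := A (enum_val k) j.
have cola j : \sum_k a k j ^+ 2 <= 1.
  apply: le_trans (col1 j).
  rewrite (_ : \sum_k _ = \sum_(i in P) A i j ^+ 2); last by rewrite [RHS]big_enum_val.
  rewrite [leLHS]big_mkcond.
  by apply: ler_sum => i _; case: ifP => // _; exact: sqr_ge0.
have P_le : #|P|%:R <= n%:R ^+ 2 :> R.
  have : #|P|%:R * n%:R^-1 <= n%:R :> R.
    rewrite -[in leRHS](card_ord n) -!sum1_card !natr_sum mulr_suml.
    apply: (@le_trans _ _ (\sum_(i in P) \sum_j A i j ^+ 2)).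
      by apply: ler_sum => i; rewrite inE mul1r => /ltW.
    rewrite exchange_big/=; apply: ler_sum => j _.
    apply: le_trans (col1 j); rewrite [leLHS]big_mkcond.
    by apply: ler_sum => i _; case: ifP => // _; exact: sqr_ge0.
  by rewrite ler_pdivrMr ?ltr0n.
(* The right side is [n^4], as [lam^4 = ln n]. *)
have count : ell%:R * n%:R + #|'I_#|P| |%:R + 1 <= expR (4 * lam ^+ 4).
  rewrite card_ord lam4 expRM_natl lnK ?posrE ?ltr0n//.
  have LamL : Lam <= L by rewrite ltW// ln_sublinear.
  have Ln : L <= n%:R by rewrite ltW// ln_sublinear// ltr0n.
  move: P_le nR3 ell_le; set N := n%:R; set e := ell%:R; set q := #|P|%:R.
  move=> h1 h2 h3.
  have : e * N <= (2 * N + 1) * N by rewrite ler_wpM2r; lra.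
  have -> : N ^+ 4 = N ^+ 2 * N ^+ 2 by ring.
  have : 9 * N ^+ 2 <= N ^+ 2 * N ^+ 2 by rewrite ler_wpM2r ?sqr_ge0//; nra.
  by nra.
have lam_ell : lam ^+ 4 <= 2 ^+ ell.
  apply: le_trans (le_expR_half_pow _ _); rewrite lam4 -[leLHS]lnK ?posrE// ler_expR.
  by rewrite -/Lam; lra.
have [x [xs xd]] := exists_signing n0 ell0 lam1 cola count lam_ell.
pose X : 'cV[R]_n := \col_j x j.
have sX : signings X by move=> j; rewrite mxE.
apply: le_trans (disc_le A sX) _.
have bound : (ell%:R + 2) * (528 * ell%:R ^+ 2 * lam + 1024 * lam) <=
    3 * (528 + 1024) * K ^+ 3 * lam * Lam ^+ 3.
  exact: rounding_cost_le.
have one_le : 1 <= (ell%:R + 2) * (528 * ell%:R ^+ 2 * lam + 1024 * lam).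
  exact: rounding_cost_ge1.
rewrite mx_normrE; apply/bigmax_leP; split => [|[i j] _ /=].
  exact: le_trans ler01 (le_trans one_le bound).
rewrite ord1 mxE; apply: le_trans bound.
have -> : \sum_j A i j * X j 0 = \sum_j A i j * x j.
  by apply: eq_bigr => k _; rewrite mxE.
have [iP|iP] := boolP (i \in P).
  have := xd (enum_rank_in iP i); rewrite /a.
  by under eq_bigr do rewrite enum_rankK_in//.
apply: le_trans one_le; apply: le_trans (ler_norm_sum _ _ _) _.
under eq_bigr do rewrite normrM.
rewrite (_ : \sum_j _ = \sum_j `|A i j|); last first.
  apply: eq_bigr => k _; suff -> : `|x k| = 1 by rewrite mulr1.
  by case: (xs k) => ->; rewrite ?normrN normr1.
by apply: sum_norm_le1 => //; move: iP; rewrite inE -leNgt.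
Qed.
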